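(* Let $\mathcal F$ be a filter on $\omega$ which is homogeneous and isomorphic to $\mathcal F\times\omega$, and which satisfies: whenever $f:\omega\to\omega$ is unbounded on every $F\in\mathcal F$, there is some $A\in\mathcal F^+$ such that $f\restriction A$ is finite-to-one. Let $T_\alpha$ ($\alpha$ an ordinal) be the spaces associated with $\mathcal F$. Then $T_{\omega_1}$ is $\omega_1$-Toronto and $T_{\omega_1+1}$ is $(\omega_1+1)$-Toronto (although neither of these two spaces has all of its levels countable). However, $T_{\omega_1+2}$ is not $(\omega_1+2)$-Toronto.
   Context: Filters are proper. Filters $\mathcal F$ on $A$ and $\mathcal G$ on $B$ are isomorphic if some bijection $t:A\to B$ satisfies $S\in\mathcal F\iff t(S)\in\mathcal G$ for all $S\subset A$. For a filter $\mathcal F$ on $\omega$, $\mathcal F^+$ is the family of all $X\subset\omega$ meeting every $F\in\mathcal F$; $\mathcal F\restriction X=\{F\cap X:F\in\mathcal F\}$. $\mathcal F$ is homogeneous if $\mathcal F\restriction X$ is isomorphic to $\mathcal F$ for every $X\in\mathcal F^+$. $\mathcal F\times\omega$ is the filter on $\omega\times\omega$ generated by the sets $F\times\omega$, $F\in\mathcal F$. For disjoint spaces $X_n$ ($n\in\omega$), $(X_n)_{n\in\omega}\cup_{\mathcal F}\{\infty\}$ denotes the space on the set $\{\infty\}\cup\bigcup_n X_n$ in which each $X_n$ is a clopen subspace and a neighborhood base at $\infty$ consists of the sets $\{\infty\}\cup\bigcup_{n\in F}X_n$, $F\in\mathcal F$. The spaces $T_\alpha$: $T_0=\emptyset$, $T_1$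 is a one-point space, $T_{\alpha+1}=(\{n\}\times T_\alpha)_{n\in\omega}\cup_{\mathcal F}\{\infty\}$, and $T_\alpha=\bigoplus_{\beta<\alpha}T_\beta$ (topological sum) for limit $\alpha$. For a space $X$: $X^0=X$, $X^{\alpha+1}$ is the set of non-isolated points of $X^\alpha$, $X^\alpha=\bigcap_{\beta<\alpha}X^\beta$ for limit $\alpha$. The set $X^\alpha\setminus X^{\alpha+1}$ is the $\alpha$-th level of $X$. $X$ is scattered if some $X^\alpha=\emptyset$; the least such $\alpha$ is the rank $r(X)$. $X$ is $\alpha$-Toronto if it is scattered of rank $\alpha$ and homeomorphic to each of its subspaces of rank $\alpha$. *)

(* Defs.v *)
From HB Require Import structures.
From mathcomp Require Import all_boot all_order.
From mathcomp Require Import all_classical topology.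

Set Implicit Arguments.
Unset Strict Implicit.
Unset Printing Implicit Defensive.

Import Order.TTheory.

Local Open Scope classical_set_scope.
Local Open Scope order_scope.

(** * Filters *)

Definition filter_iso (A B : Type) (F : set_system A) (G : set_system B) : Prop :=
  exists2 t : A -> B, bijective t & forall S : set A, F S <-> G (t @` S).

Definition positive_sets (F : set_system nat) : set_system nat :=
  [set X | forall A, F A -> X `&` A !=set0].

(* The trace of [F] on [X], as a set system on the type of elements of [X]:
   [set_val @^-1` A] is the set A /\ X seen inside [X]. *)
Definition trace_filter (F : set_system nat) (X : set nat) :
    set_system X :=
  [set @set_val _ X @^-1` A | A in F].

Definition homogeneous_filter (F : set_system nat) : Prop :=
  forall X : set nat, positive_sets F X -> filter_iso (@trace_filter F X) F.

Definition filter_times_omega (F : set_system nat) : set_system (nat * nat) :=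
  filter_from F (fun A => A `*` [set: nat]).

Definition unbounded_on (f : nat -> nat) (A : set nat) : Prop :=
  forall m : nat, exists2 n, A n & (m < f n)%N.

Definition finite_to_one_on (f : nat -> nat) (A : set nat) : Prop :=
  forall k : nat, finite_set (A `&` f @^-1` [set k]).

(** * Ordinals *)

(* Ordinals are the elements of a well-ordered type [W], an element [a] standing
   for the order type of its initial segment [[set b | b < a]]. *)
Section Ordinals.
Context {d : Order.disp_t} {W : orderType d}.
Implicit Types a b c : W.

Definition is_zero a : Prop := forall b, a <= b.

Definition is_succ b a : Prop := b < a /\ forall c, b < c -> a <= c.

Definition is_limit a : Prop := ~ is_zero a /\ forall b, ~ is_succ b a.

Definition is_omega1 a : Prop :=
  ~ countable [set b | b < a] /\ forall b, b < a -> countable [set c | c < b].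

Lemma is_succ_inj b c a : is_succ b a -> is_succ c a -> b = c.
Proof.
move=> [ba bS] [ca cS]; apply/eqP; rewrite eq_le; apply/andP; split.
- by rewrite leNgt; apply/negP => /cS; rewrite leNgt ba.
- by rewrite leNgt; apply/negP => /bS; rewrite leNgt ca.
Qed.

Section Recursion.
Variables (wfW : well_founded (fun a b : W => a < b)) (P : Type).
Variables (z : P) (s : W -> P -> P) (l : forall a, ({b : W | b < a} -> P) -> P).

Definition transfinite_step a (rec : forall b, b < a -> P) : P :=
  match pselect (is_zero a), pselect (exists b, is_succ b a) with
  | left _, _ => z
  | right _, left aS => let b := cid aS in
      s (projT1 b) (rec (projT1 b) (proj1 (projT2 b)))
  | right _, right _ => l (fun b : {b : W | b < a} => rec (val b) (valP b))
  end.

(* The function [f : W -> P] such that [f 0 = z], [f (b + 1) = s b (f b)] and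
   [f a = l (fun b : {b | b < a} => f b)] for limit [a]; see the three
   [transfinite_rec] equations below. *)
Definition transfinite_rec : W -> P := Fix wfW (fun=> P) transfinite_step.

Lemma transfinite_recE a :
  transfinite_rec a = transfinite_step (fun b (_ : b < a) => transfinite_rec b).
Proof.
rewrite /transfinite_rec Fix_eq// => x f g fg.
by congr transfinite_step; apply/functional_extensionality_dep => b;
  apply/functional_extensionality_dep => ba.
Qed.

Lemma transfinite_rec0 a : is_zero a -> transfinite_rec a = z.
Proof. by rewrite transfinite_recE /transfinite_step; case: pselect. Qed.

Lemma transfinite_recS b a :
  is_succ b a -> transfinite_rec a = s b (transfinite_rec b).
Proof.
move=> ab; rewrite transfinite_recE /transfinite_step.
case: pselect => [a0|_].
  by have := a0 b; rewrite leNgt (proj1 ab).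
case: pselect => [aS|[]]; last by exists b.
by rewrite (is_succ_inj (projT2 (cid aS)) ab).
Qed.

Lemma transfinite_recL a :
  is_limit a -> transfinite_rec a = l (fun b : {b : W | b < a} => transfinite_rec (val b)).
Proof.
move=> [a0 aS]; rewrite transfinite_recE /transfinite_step.
case: pselect => // _; case: pselect => // aS'.
by have [b ab] := aS'; case: (aS b ab).
Qed.

End Recursion.
End Ordinals.

(** * The spaces *)

(* The space (X_n)_n \cup_F {\infty}: [None] is the point \infty, and
   [Some (existT _ n x)] is the point [x] of [X n]. *)
Definition filter_sum (F : set_system nat) (FF : ProperFilter F)
  (X : nat -> topologicalType) : Type := option {n : nat & X n}.

Section FilterSum.
Variables (F : set_system nat) (FF : ProperFilter F) (X : nat -> topologicalType).

Local Notation fsum := (filter_sum FF X).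

HB.instance Definition _ := Choice.on fsum.

Definition filter_sum_nbhs (p : fsum) : set_system fsum :=
  if p is Some x then Some @ nbhs x else
    filter_from F (fun A => None |` Some @` [set x | A (projT1 x)]).

Let filter_sum_nbhs_filter (p : fsum) : ProperFilter (filter_sum_nbhs p).
Proof.
case: p => [x|]; first exact: fmap_proper_filter.
apply: filter_from_proper; last by move=> ? _; exists None; left.
apply: filter_from_filter; first by exists setT; exact: filterT.
move=> A B FA FB; exists (A `&` B); first exact: filterI.
move=> _ [->|[x [Ax Bx] <-]]; first by split; left.
by split; right; exists x.
Qed.

Let filter_sum_nbhs_singleton (p : fsum) U : filter_sum_nbhs p U -> U p.
Proof. by case: p => [x /= /nbhs_singleton//|[A _]]; apply; left. Qed.

Let filter_sum_nbhs_nbhs (p : fsum) U :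
  filter_sum_nbhs p U -> filter_sum_nbhs p (filter_sum_nbhs^~ U).
Proof.
case: p => [x|] /=.
  rewrite nbhs_simpl nbhsE => -[V [oV Vx] VU].
  by exists V => // y /= Vy; rewrite nbhs_simpl nbhsE; exists V.
move=> [A FA AU]; exists A => // _ [->|[[n x] /= An <-]]; first by exists A.
apply: (@filterS _ _ _ (existT X n @` setT)).
  by move=> _ [y _ <-]; apply: AU; right; exists (existT X n y).
by apply: existT_nbhs; exact: filterT.
Qed.

HB.instance Definition _ := hasNbhs.Build fsum filter_sum_nbhs.
HB.instance Definition _ := @Nbhs_isNbhsTopological.Build fsum
  filter_sum_nbhs_filter filter_sum_nbhs_singleton filter_sum_nbhs_nbhs.

End FilterSum.

HB.instance Definition _ := hasNbhs.Build void principal_filter.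
HB.instance Definition _ := Discrete_ofNbhs.Build void erefl.
HB.instance Definition _ := hasNbhs.Build unit principal_filter.
HB.instance Definition _ := Discrete_ofNbhs.Build unit erefl.

Definition T_space {d : Order.disp_t} {W : orderType d}
    (wfW : well_founded (fun a b : W => a < b))
    (F : set_system nat) (FF : ProperFilter F) : W -> topologicalType :=
  transfinite_rec wfW
    (void : topologicalType)
    (fun b X => if pselect (is_zero b) then (unit : topologicalType)
                else (filter_sum FF (fun=> X) : topologicalType))
    (fun a X => ({b : {b : W | b < a} & X b} : topologicalType)).

(** * Levels, rank and Toronto spaces *)

Definition homeomorphic (X Y : topologicalType) : Prop :=
  exists (f : X -> Y) (g : Y -> X),
    [/\ cancel f g, cancel g f, continuous f & continuous g].

Definition derived_set (X : topologicalType) (A : set X) : set X :=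
  A `\` isolated A.

Section Toronto.
Local Unset Implicit Arguments.
Context {d : Order.disp_t} {W : orderType d}.
Variable wfW : well_founded (fun a b : W => a < b).

Definition cb_derivative (X : topologicalType) : W -> set X :=
  transfinite_rec wfW setT (fun _ A => derived_set A)
    (fun a A => \bigcap_(b in [set: {b : W | b < a}]) A b).

(* X^a minus X^(a+1), where X^(a+1) is by definition [derived_set] of X^a; this
   form also makes sense when [a] is the last element of [W]. *)
Definition cb_level (X : topologicalType) (a : W) : set X :=
  cb_derivative X a `\` derived_set (cb_derivative X a).

(* The ordinals up to [a] suffice to express that the rank is [a]. *)
Definition scattered_of_rank (a : W) (X : topologicalType) : Prop :=
  cb_derivative X a = set0 /\ forall b, b < a -> cb_derivative X b <> set0.

(* Subspaces of [X] are the types of elements of sets [Y : set X], with the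
   topology induced by the inclusion into [X]. *)
Definition Toronto (a : W) (X : topologicalType) : Prop :=
  scattered_of_rank a X /\
  forall Y : set X, scattered_of_rank a (set_type Y) ->
    homeomorphic X (set_type Y).

End Toronto.

(* Main.v *)
From HB Require Import structures.
Require Import Defs.
From mathcomp Require Import all_boot all_order.
From mathcomp Require Import all_classical topology.

(** Write T(a) for the spaces T_a.  The whole argument takes place among
    topological sums of such spaces, compared through absorption: X absorbs Y
    when X + Y is homeomorphic to X, and two spaces that absorb each other are
    homeomorphic ([absorbs_antisym]).  Cantor-Bernstein arguments fail for
    clopen embeddings of general spaces, but absorption can be checked summand
    by summand.

    The filter enters through regrouping.  As F is homogeneous and isomorphic
    to F x omega, for every positive set A there is a map p on omega under
    which F is the preimage of itself and all of whose fibres meet A in an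
    infinite set ([infinite_fibers]).  Replacing (X_n)_n by the sums of the X_n
    over the fibres of p does not change (X_n)_n \cup_F {oo} ([fsum_fiber]), so
    only sums of pieces that include infinitely many of those over A have to be
    recognised ([fsum_regroup]).  In particular T(a + 1) is also built from
    infinitely many copies of T(a) at each place, and it follows by induction
    that T(a) absorbs T(b) for b < a ([T_absorbs]).

    For countable a, every subspace of T(a) is a countable sum of spaces T(b)
    with b <= a ([T_subspace_sum_of_T]).  The critical case is a subspace of
    T(c + 1) that contains the point oo, say (Z_n)_n \cup_F {oo}.  Let g be
    least such that Z_n is a sum of spaces T(b) with b <= g for F-almost all n.
    The map sending n to the first place, in an enumeration of the ordinals
    below g, of a bound that suffices for Z_n is unbounded on every set of F,
    hence finite-to-one on some positive set A.  So for each g' < g all but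
    finitely many n in A need an ordinal above g', the sum of infinitely many
    such Z_n is the sum of infinitely many T(g) ([ample_sum_homeo]), and the
    subspace is T(g + 1) ([fsum_collapse]) up to a clopen part that is a
    countable sum of subspaces of T(c).

    A subspace Y of T(omega_1) is therefore a sum of countable spaces T(b), so
    T(omega_1) absorbs it.  If Y has rank omega_1, the ordinals b that occur
    are unbounded in omega_1, and regularity of omega_1 gives an injection
    along which Y absorbs T(omega_1).  For rank omega_1 + 1, countably many
    ordinals below omega_1 are bounded, so the places n where Y_n has rank
    omega_1 form a positive set, there Y_n is T(omega_1), and all other places
    are absorbed.

    At omega_1 + 2 this breaks down.  A subspace may contain the top point of
    one copy of T(omega_1 + 1) together with nothing but the isolated points
    of the copies of T(omega_1) below it.  That point has Cantor-Bendixson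
    level 1 and no countable neighbourhood, whereas in T(omega_1 + 2) each
    point of level below omega_1 lies in a countable open set T(b). *)

Set Implicit Arguments.
Unset Strict Implicit.
Unset Printing Implicit Defensive.
Import Order.TTheory.

Local Open Scope order_scope.
Local Open Scope classical_set_scope.

(** * Homeomorphisms and topological sums *)

Notation "X ≅ Y" := (homeomorphic X Y) (at level 70, no associativity).

Lemma inj_surj_bijective (A B : Type) (f : A -> B) :
  injective f -> (forall y, exists x, f x = y) -> bijective f.
Proof.
move=> fI /choice[g fg]; exists g => // x.
by apply: fI; rewrite fg.
Qed.

(** For injective [f] this says that [f] is an open embedding; in this form it
    needs no case distinction for maps out of a sum. *)
Definition local_homeo (X Y : topologicalType) (f : X -> Y) : Prop :=
  forall x (U : set Y), nbhs (f x) U <-> nbhs x (f @^-1` U).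

Lemma homeo_intro (X Y : topologicalType) (f : X -> Y) :
  injective f -> (forall y, exists x, f x = y) -> local_homeo f -> X ≅ Y.
Proof.
move=> fI fS fh; have [g fK gK] := inj_surj_bijective fI fS.
exists f, g; split => //.
- by move=> x U /fh.
- move=> y U; case: (fS y) => x <-; rewrite fK => xU.
  by apply/fh; apply: filterS xU => z Uz /=; rewrite fK.
Qed.

Lemma homeo_elim (X Y : topologicalType) : X ≅ Y ->
  exists f : X -> Y,
    [/\ injective f, forall y, exists x, f x = y & local_homeo f].
Proof.
move=> [f [g [fK gK fc gc]]]; exists f; split.
- exact: can_inj fK.
- by move=> y; exists (g y).
- move=> x U; split; first exact: fc.
  move=> xU; have : nbhs (f x) (g @^-1` (f @^-1` U)) by apply: gc; rewrite fK.
  by apply: filterS => y /=; rewrite gK.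
Qed.

Lemma homeo_refl (X : topologicalType) : X ≅ X.
Proof. by exists id, id; split => // x; exact: cvg_id. Qed.

Lemma homeo_sym (X Y : topologicalType) : X ≅ Y -> Y ≅ X.
Proof. by move=> [f [g [? ? ? ?]]]; exists g, f. Qed.

Lemma homeo_trans (X Y Z : topologicalType) : X ≅ Y -> Y ≅ Z -> X ≅ Z.
Proof.
move=> [f [g [fK gK fc gc]]] [f' [g' [fK' gK' fc' gc']]].
exists (f' \o f), (g \o g'); split.
- exact: can_comp.
- exact: can_comp.
- by move=> x; apply: continuous_comp; [exact: fc|exact: fc'].
- by move=> x; apply: continuous_comp; [exact: gc'|exact: gc].
Qed.

Section SumTopology.
Variables X Y : topologicalType.

Definition sum_nbhs (p : X + Y) : set_system (X + Y) :=
  match p with inl x => inl @ nbhs x | inr y => inr @ nbhs y end.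

HB.instance Definition _ := hasNbhs.Build (X + Y)%type sum_nbhs.

Let sum_nbhs_proper p : ProperFilter (sum_nbhs p).
Proof. by case: p => x; exact: fmap_proper_filter. Qed.

Let sum_nbhs_singleton p U : sum_nbhs p U -> U p.
Proof. by case: p => x; exact: nbhs_singleton. Qed.

Let sum_nbhs_nbhs p U : sum_nbhs p U -> sum_nbhs p (sum_nbhs^~ U).
Proof. by case: p => x /=; rewrite !nbhs_simpl => /nbhs_interior. Qed.

HB.instance Definition _ := Nbhs_isNbhsTopological.Build (X + Y)%type
  sum_nbhs_proper sum_nbhs_singleton sum_nbhs_nbhs.

End SumTopology.


Section SumTheory.
Implicit Types (X Y Z : topologicalType) (I J K : choiceType).

Lemma existT_local_homeo I (X : I -> topologicalType) i :
  local_homeo (existT X i).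
Proof. by []. Qed.

Lemma existT_inj I (X : I -> topologicalType) i : injective (existT X i).
Proof. by move=> x y xy; exact: existT_inj2 xy. Qed.

Lemma sum_local_homeo X Y Z (f : X + Y -> Z) :
  local_homeo (f \o inl) -> local_homeo (f \o inr) -> local_homeo f.
Proof. by move=> fl fr [x|y] U; [exact: (fl x U)|exact: (fr y U)]. Qed.

Lemma sigT_local_homeo I (X : I -> topologicalType) Z (f : {i & X i} -> Z) :
  (forall i, local_homeo (f \o existT X i)) -> local_homeo f.
Proof. by move=> fi [i x] U; exact: (fi i x U). Qed.

Lemma sum_congr X Y X' Y' :
  X ≅ X' -> Y ≅ Y' -> (X + Y)%type ≅ (X' + Y')%type.
Proof.
move=> /homeo_elim[f [fI fS fh]] /homeo_elim[g [gI gS gh]].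
apply: (@homeo_intro _ _ (fun p => match p with
  inl x => inl (f x) | inr y => inr (g y) end)).
- by move=> [x|y] [x'|y'] // [] => [/fI|/gI] ->.
- move=> [x|y]; first by have [z <-] := fS x; exists (inl z).
  by have [z <-] := gS y; exists (inr z).
- apply: sum_local_homeo => x U; [exact: (fh x (inl @^-1` U))|].
  exact: (gh x (inr @^-1` U)).
Qed.

Lemma sum_comm X Y : (X + Y)%type ≅ (Y + X)%type.
Proof.
apply: (@homeo_intro _ _ (fun p => match p with
  inl x => inr x | inr y => inl y end)).
- by move=> [x|y] [x'|y'] // [] ->.
- by move=> [x|y]; [exists (inr x)|exists (inl y)].
- exact: sum_local_homeo.
Qed.

Lemma sum_assoc X Y Z : (X + (Y + Z))%type ≅ ((X + Y) + Z)%type.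
Proof.
apply: (@homeo_intro _ _ (fun p : X + (Y + Z) => match p with
  inl x => inl (inl x) | inr (inl y) => inl (inr y)
  | inr (inr z) => inr z end)).
- by move=> [x|[x|x]] [y|[y|y]] // [] ->.
- by move=> [[x|x]|x];
    [exists (inl x)|exists (inr (inl x))|exists (inr (inr x))].
- by apply: sum_local_homeo => //; exact: sum_local_homeo.
Qed.

Lemma sum_empty X Y : (Y -> False) -> (X + Y)%type ≅ X.
Proof.
move=> Y0; apply: homeo_sym.
apply: (@homeo_intro _ _ (@inl X Y)) => //; first by move=> x y [].
by move=> [x|/Y0//]; exists x.
Qed.

Lemma homeo_empty X Y : (X -> False) -> (Y -> False) -> X ≅ Y.
Proof.
move=> X0 Y0; apply: (@homeo_intro _ _ (fun x => False_rect Y (X0 x))).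
- by move=> x.
- by move=> y; case: Y0.
- by move=> x.
Qed.

Lemma sum_exchange X Y Z : ((X + Y) + Z)%type ≅ ((X + Z) + Y)%type.
Proof.
apply: homeo_trans (sum_assoc _ _ _).
apply: homeo_trans (homeo_sym (sum_assoc _ _ _)) _.
by apply: sum_congr; [exact: homeo_refl|exact: sum_comm].
Qed.

Lemma sigT_congr I (X Y : I -> topologicalType) :
  (forall i, X i ≅ Y i) -> {i & X i} ≅ {i & Y i}.
Proof.
move=> XY; pose f i := projT1 (cid (homeo_elim (XY i))).
have fP i : [/\ injective (f i), forall y, exists x, f i x = y
    & local_homeo (f i)] by rewrite /f; case: cid.
apply: (@homeo_intro _ _ (fun p => let: existT i x := p in existT Y i (f i x))).
- move=> [i x] [j y] /= pq; have ij := existT_inj1 pq; subst j.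
  have {}pq := existT_inj2 pq.
  by have [fI _ _] := fP i; rewrite (fI _ _ pq).
- move=> [i y]; have [_ fS _] := fP i.
  by have [x <-] := fS y; exists (existT _ i x).
- apply: sigT_local_homeo => i x U; have [_ _ fh] := fP i.
  exact: (fh x (existT Y i @^-1` U)).
Qed.

Lemma sigT_reindex I J (e : I -> J) (X : J -> topologicalType) :
  injective e -> (forall j, exists i, e i = j) ->
  {i & X (e i)} ≅ {j & X j}.
Proof.
move=> eI eS.
apply: (@homeo_intro _ _ (fun p : {i & X (e i)} =>
  let: existT i x := p in existT X (e i) x)).
- move=> [i x] [j y] /= pq; have ij := eI _ _ (existT_inj1 pq); subst j.
  by rewrite (existT_inj2 pq).
- by move=> [j]; have [i <-] := eS j; move=> x; exists (existT _ i x).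
- exact: sigT_local_homeo.
Qed.

Lemma sigT_flatten I J (X : I -> J -> topologicalType) :
  {i & {j & X i j}} ≅ {p : I * J & X p.1 p.2}.
Proof.
apply: homeo_sym.
apply: (@homeo_intro _ _ (fun q : {p : I * J & X p.1 p.2} =>
  existT (fun i => {j & X i j}) (tag q).1
    (existT (X (tag q).1) (tag q).2 (tagged q)))).
- move=> [[i j] x] [[i' j'] y] /= pq; have ii := existT_inj1 pq; subst i'.
  have pq2 := existT_inj2 pq; have jj := existT_inj1 pq2; subst j'.
  by rewrite (existT_inj2 pq2).
- by move=> [i [j x]]; exists (existT _ (i, j) x).
- exact: sigT_local_homeo.
Qed.

Lemma sigT_fiber I K (p : K -> I) (X : K -> topologicalType) :
  {k & X k} ≅ {i & {k : [set k | p k = i] & X (val k)}}.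
Proof.
apply: homeo_sym.
apply: (@homeo_intro _ _
  (fun q : {i & {k : [set k | p k = i] & X (val k)}} =>
  existT X (val (tag (tagged q))) (tagged (tagged q)))).
- move=> [i [[k kP] x]] [i' [[k' kP'] y]] /= pq.
  have kk := existT_inj1 pq; subst k'.
  have ii : i = i' by rewrite -(set_mem kP : p k = i) (set_mem kP' : p k = i').
  subst i'; have kk := bool_irrelevance kP kP'; subst kP'.
  by rewrite (existT_inj2 pq).
- move=> [k x].
  by exists (existT _ (p k) (existT _ (exist _ k (mem_set erefl)) x)).
- by apply: sigT_local_homeo => i; exact: sigT_local_homeo.
Qed.

Lemma sigT_split I (D : set I) (X : I -> topologicalType) :
  {i & X i} ≅ ({i : D & X (val i)} + {i : set_type (~` D) & X (val i)})%type.
Proof.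
apply: homeo_sym.
apply: (@homeo_intro _ _ (fun q => match q with
    inl q => existT X (val (tag q)) (tagged q)
  | inr q => existT X (val (tag q)) (tagged q) end)).
- move=> [[[i iD] x]|[[i iD] x]] [[[j jD] y]|[[j jD] y]] /= pq;
    have ij := existT_inj1 pq; subst j.
  + have ij := bool_irrelevance iD jD; subst jD.
    by rewrite (existT_inj2 pq).
  + by case: (set_mem jD); exact: set_mem iD.
  + by case: (set_mem iD); exact: set_mem jD.
  + have ij := bool_irrelevance iD jD; subst jD.
    by rewrite (existT_inj2 pq).
- move=> [i x]; have [iD|iD] := pselect (D i).
    by exists (inl (existT _ (exist _ i (mem_set iD)) x)).
  by exists (inr (existT _ (exist _ i (mem_set iD)) x)).
- by apply: sum_local_homeo; exact: sigT_local_homeo.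
Qed.

Lemma sum_sigT I (X Y : I -> topologicalType) :
  ({i & X i} + {i & Y i})%type ≅ {i & (X i + Y i)%type}.
Proof.
apply: (@homeo_intro _ _ (fun q => match q with
    inl (existT i x) => existT (fun i => (X i + Y i)%type) i (inl x)
  | inr (existT i x) => existT (fun i => (X i + Y i)%type) i (inr x) end)).
- move=> [[i x]|[i x]] [[j y]|[j y]] /= pq;
    have ij := existT_inj1 pq; subst j; move: (existT_inj2 pq) => //.
  + by move=> [->].
  + by move=> [->].
- by move=> [i [x|x]];
    [exists (inl (existT _ i x))|exists (inr (existT _ i x))].
- by apply: sum_local_homeo; exact: sigT_local_homeo.
Qed.

Lemma sigT_single I (i : I) (X : I -> topologicalType) :
  (forall j, j = i) -> {j & X j} ≅ X i.
Proof.
move=> I1; apply: homeo_sym; apply: (@homeo_intro _ _ (existT X i)) => //.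
  exact: existT_inj.
by move=> [j x]; have := I1 j; move=> ji; subst j; exists x.
Qed.

End SumTheory.

(** * Subspaces *)

Section Subspaces.
Implicit Types (X Y Z : topologicalType) (I J K : choiceType).

Lemma nbhs_set_type X (A : set X) (y : A) (U : set A) :
  nbhs y U <-> exists2 V, nbhs (val y) V & @set_val _ A @^-1` V `<=` U.
Proof.
split.
  rewrite (nbhsE y) => -[_ [[V oV <-] Vy] VU].
  by exists V => //; apply: open_nbhs_nbhs.
move=> [V + VU]; rewrite nbhsE => -[W [oW Wy] WV].
rewrite nbhsE; exists (@set_val _ A @^-1` W).
  by split => //; exists W.
by move=> z Wz; apply/VU/WV.
Qed.

Lemma set_val_inj X (A : set X) : injective (@set_val _ A).
Proof. exact: val_inj. Qed.

Lemma local_homeo_to_set_type X Z (A : set X) (f : Z -> A) :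
  (forall z (U : set X), nbhs (val (f z)) U -> nbhs z ((val \o f) @^-1` U)) ->
  (forall z (U : set Z), nbhs z U -> exists2 V, nbhs (val (f z)) V &
     forall z', V (val (f z')) -> U z') ->
  (forall y, exists z, f z = y) ->
  local_homeo f.
Proof.
move=> fc fo fS z U; rewrite nbhs_set_type; split.
  by move=> [V /fc fV VU]; apply: filterS fV => t; exact: VU.
move=> /fo[V fV VU]; exists V => // y Vy.
by have [t ty] := fS y; rewrite -ty; apply: VU; rewrite ty.
Qed.

Lemma set_val_local_homeo X (A : set X) :
  open A -> local_homeo (@set_val _ A).
Proof.
move=> oA y U; rewrite nbhs_set_type; split; first by exists U.
move=> [V yV VU].
have : nbhs (val y) A.
  by apply: open_nbhs_nbhs; split => //; exact: set_mem (valP y).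
move: yV; apply: filterS2 => x Vx Ax.
exact: (VU (exist _ x (mem_set Ax))).
Qed.

Lemma set_type_homeo X X' (h : X -> X') (Y : set X') :
  injective h -> (forall y, exists x, h x = y) -> local_homeo h ->
  set_type (h @^-1` Y) ≅ set_type Y.
Proof.
move=> hI hS hh.
pose f (x : set_type (h @^-1` Y)) : Y :=
  exist _ (h (val x)) (mem_set (set_mem (valP x))).
have fS y : exists x, f x = y.
  case: y => y yY; have [x xy] := hS y; subst y.
  exists (exist _ x (mem_set (set_mem yY : (h @^-1` Y) x))).
  exact: val_inj.
apply: (@homeo_intro _ _ f) => //.
- by move=> x y [] /hI /val_inj.
- apply: local_homeo_to_set_type => //.
  + move=> x U /hh hU; apply/nbhs_set_type.
    by exists (h @^-1` U).
  + move=> x U /nbhs_set_type[V xV VU]; exists (h @` V).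
      apply/hh; apply: filterS xV => z Vz; by exists z.
    by move=> z [t Vt /hI tz]; rewrite tz in Vt; exact: VU.
Qed.

Lemma set_typeT X (A : set X) : (forall x, A x) -> set_type A ≅ X.
Proof.
move=> AT; apply: (@homeo_intro _ _ (@set_val _ A)).
- exact: set_val_inj.
- by move=> x; exists (exist _ x (mem_set (AT x))).
- have -> : A = setT by apply/seteqP; split.
  exact/set_val_local_homeo/openT.
Qed.

Lemma set_type_sigT I (X : I -> topologicalType) (Y : set {i & X i}) :
  {i & set_type (existT X i @^-1` Y)} ≅ set_type Y.
Proof.
pose f (p : {i & set_type (existT X i @^-1` Y)}) : Y :=
  exist _ (existT X (tag p) (val (tagged p)))
    (mem_set (set_mem (valP (tagged p)))).
have fI : injective f.
  move=> [i [x xY]] [j [y yY]] /(congr1 val) /= pq.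
  have ij := existT_inj1 pq; subst j.
  have xy := existT_inj2 pq; subst y.
  by rewrite (bool_irrelevance xY yY).
have fS y : exists x, f x = y.
  case: y => -[i x] xY.
  exists (existT (fun i => set_type (existT X i @^-1` Y)) i
    (exist _ x (mem_set (set_mem xY : (existT X i @^-1` Y) x)))).
  exact: val_inj.
apply: (@homeo_intro _ _ f) => //.
apply: local_homeo_to_set_type => //.
- move=> [i x] U xU; have : nbhs (val x) (existT X i @^-1` U) by [].
  by move=> ?; apply/nbhs_set_type; exists (existT X i @^-1` U).
- move=> [i x] U /nbhs_set_type[V xV VU]; exists (existT X i @` V).
    exact: existT_nbhs.
  move=> [j y] [z Vz /= pq]; have ij := existT_inj1 pq; subst j.
  by apply: VU; move: Vz; rewrite (existT_inj2 pq).
Qed.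

Lemma set_type_split X (A C : set X) :
  open C -> open (~` C) ->
  set_type A ≅ (set_type (A `&` C) + set_type (A `&` ~` C))%type.
Proof.
move=> oC oC'; apply: homeo_sym.
pose f (p : set_type (A `&` C) + set_type (A `&` ~` C)) : A :=
  match p with
  | inl x => exist _ (val x) (mem_set (proj1 (set_mem (valP x))))
  | inr x => exist _ (val x) (mem_set (proj1 (set_mem (valP x)))) end.
have fS y : exists x, f x = y.
  case: y => x xA; have [xC|xC] := pselect (C x).
    exists (inl (exist _ x (mem_set (conj (set_mem xA) xC)))).
    exact: val_inj.
  exists (inr (exist _ x (mem_set (conj (set_mem xA) xC)))).
  exact: val_inj.
have inC (x : set_type (A `&` C)) : C (val x).
  by case: (set_mem (valP x)).
have inC' (x : set_type (A `&` ~` C)) : (~` C) (val x).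
  by case: (set_mem (valP x)).
apply: (@homeo_intro _ _ f) => //.
- move=> [x|x] [y|y] [].
  + by move=> /val_inj ->.
  + by move=> xy; case: (inC' y : ~ C (sval y)); rewrite -xy; exact: inC.
  + by move=> xy; case: (inC' x : ~ C (sval x)); rewrite xy; exact: inC.
  + by move=> /val_inj ->.
- apply: local_homeo_to_set_type => //.
  + by move=> [x|x] U xU; apply/nbhs_set_type; exists U.
  + move=> [x|x] U /nbhs_set_type[V xV VU].
      exists (V `&` C) => /=.
        apply: filterI => //; apply: open_nbhs_nbhs; split => //.
        exact: inC.
      by move=> [y|y] [] //=; [move=> Vy _; exact: VU|move=> _ /(inC' y)].
    exists (V `&` ~` C) => /=.
      apply: filterI => //; apply: open_nbhs_nbhs; split => //.
      exact: inC'.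
    by move=> [y|y] [] //=; [move=> _ /(_ (inC y))|move=> Vy _; exact: VU].
Qed.

Lemma split_range X Z (f : X -> Z) :
  injective f -> local_homeo f -> open (~` range f) ->
  Z ≅ (X + set_type (~` range f))%type.
Proof.
move=> fI fh fo; apply: homeo_sym.
apply: (@homeo_intro _ _ (fun p : X + set_type (~` range f) =>
  match p with inl x => f x | inr z => val z end)).
- move=> [x|[x xf]] [y|[y yf]] /=.
  + by move=> /fI ->.
  + by move=> xy; case: (set_mem yf); exists x.
  + by move=> xy; case: (set_mem xf); exists y.
  + by move=> xy; congr inr; exact: val_inj.
- move=> z; have [[x _ <-]|zf] := pselect (range f z); first by exists (inl x).
  by exists (inr (exist _ z (mem_set zf))).
- by apply: sum_local_homeo => //; exact: set_val_local_homeo.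
Qed.

End Subspaces.

(** * The spaces (X_n)_n \cup_F {\infty} *)

Section FilterSum.
Variables (F : set_system nat) (FF : ProperFilter F).
Local Notation fsum := (filter_sum FF).
Implicit Types X Y : nat -> topologicalType.

Definition fsum_in X n (x : X n) : fsum X := Some (existT X n x).

Lemma nbhs_infinity X (U : set (fsum X)) :
  nbhs (None : fsum X) U <->
  U None /\ exists2 A, F A & forall n x, A n -> U (@fsum_in X n x).
Proof.
split.
  move=> [A FA AU]; split; first by apply: AU; left.
  by exists A => // n x An; apply: AU; right; exists (existT _ n x).
move=> [U0 [A FA AU]]; exists A => //.
by move=> _ [->//|[[n x] /= An <-]]; exact: AU.
Qed.

Lemma fsum_in_local_homeo X n : local_homeo (@fsum_in X n).
Proof. by []. Qed.

Lemma fsum_in_inj X n : injective (@fsum_in X n).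
Proof. by move=> x y /Some_inj xy; exact: existT_inj2 xy. Qed.

Lemma fsum_case X (P : fsum X -> Prop) :
  P None -> (forall n x, P (fsum_in (x : X n))) -> forall p, P p.
Proof. by move=> P0 P1 [[n x]|]; [exact: P1|exact: P0]. Qed.

Lemma fsum_congr X Y : (forall n, X n ≅ Y n) -> fsum X ≅ fsum Y.
Proof.
move=> XY; pose f n := projT1 (cid (homeo_elim (XY n))).
have fP n : [/\ injective (f n), forall y, exists x, f n x = y
    & local_homeo (f n)] by rewrite /f; case: cid.
apply: (@homeo_intro _ _ (fun p : fsum X => match p with
    Some (existT n x) => fsum_in (f n x) | None => None end)).
- move=> [[n x]|] [[m y]|] //= /Some_inj pq; have nm := existT_inj1 pq; subst m.
  have [fI _ _] := fP n.
  by rewrite (fI _ _ (existT_inj2 pq)).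
- elim/fsum_case; first by exists None.
  move=> n y; have [_ fS _] := fP n; have [x <-] := fS y.
  by exists (fsum_in x).
- elim/fsum_case => [U|n x U]; last first.
    by have [_ _ fh] := fP n; exact: (fh x (@fsum_in Y n @^-1` U)).
  rewrite !nbhs_infinity; split=> -[U0 [A FA AU]]; split => //; exists A => //.
    by move=> n x An; exact: AU.
  move=> n y An; have [_ fS _] := fP n; have [x <-] := fS y.
  exact: (AU n x An).
Qed.

(** F is generated by the preimages under [p] of its own members. *)
Definition preserves_filter (p : nat -> nat) : Prop :=
  (forall G, F G -> F (p @^-1` G)) /\
  (forall B, F B -> exists2 G, F G & p @^-1` G `<=` B).

Lemma fsum_fiber (p : nat -> nat) X : preserves_filter p ->
  fsum X ≅ fsum (fun i => {n : [set n | p n = i] & X (val n)}).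
Proof.
move=> [pF Fp]; apply: homeo_sym.
pose Y i : topologicalType := {n : [set n | p n = i] & X (val n)}.
pose f (q : fsum Y) : fsum X := match q with
  | None => None
  | Some (existT i (existT n x)) => fsum_in x end.
have fE n (x : X n) : f (@fsum_in Y (p n)
    (existT _ (exist _ n (mem_set erefl)) x)) = fsum_in x by [].
apply: (@homeo_intro _ _ f).
- move=> [[i [[k kP] x]]|] [[i' [[k' kP'] y]]|] //= /Some_inj pq.
  have kk := existT_inj1 pq; subst k'.
  have ii : i = i' by rewrite -(set_mem kP : p k = i) (set_mem kP' : p k = i').
  subst i'; have kk := bool_irrelevance kP kP'; subst kP'.
  by rewrite (existT_inj2 pq).
- elim/fsum_case; first by exists None.
  by move=> n x; rewrite -fE; eexists.
- elim/fsum_case => [U|n [k x] U]; last by [].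
  rewrite !nbhs_infinity; split=> -[U0 [A FA AU]]; split => //.
    have [G FG GA] := Fp _ FA; exists G => // i [[n /= nP] x] Gi.
    by apply: AU; apply: GA; rewrite /= (set_mem nP : p n = i).
  exists (p @^-1` A); first exact: pF.
  move=> n x An.
  by have := AU (p n) (existT _ (exist _ n (mem_set erefl)) x) An.
Qed.

Lemma set_type_fsum_in X (A : set (fsum X)) : A None ->
  fsum (fun n => set_type (@fsum_in X n @^-1` A)) ≅ set_type A.
Proof.
move=> A0; pose Y n : topologicalType := set_type (@fsum_in X n @^-1` A).
pose f (q : fsum Y) : A := match q with
  | None => exist _ None (mem_set A0)
  | Some (existT i x) => exist _ (fsum_in (val x))
      (mem_set (set_mem (valP x))) end.
have fS y : exists x, f x = y.
  case: y => -[[n x]|] xA.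
    exists (@fsum_in Y n (exist _ x (mem_set (set_mem xA :
      (@fsum_in X n @^-1` A) x)))); exact: val_inj.
  by exists None; exact: val_inj.
apply: (@homeo_intro _ _ f) => //.
- move=> [[n [x xA]]|] [[m [y yA]]|] //= /(congr1 val) //= /Some_inj pq.
  have nm := existT_inj1 pq; subst m.
  have xy := existT_inj2 pq; subst y.
  by rewrite (bool_irrelevance xA yA).
- apply: local_homeo_to_set_type => //.
  + elim/fsum_case => [U|n x U].
      move=> /nbhs_infinity[U0 [B FB BU]]; apply/nbhs_infinity; split => //.
      by exists B => // n x Bn; exact: BU.
    move=> xU; apply/nbhs_set_type; exists (@fsum_in X n @^-1` U) => //.
  + elim/fsum_case => [U|n x U].
      move=> /nbhs_infinity[U0 [B FB BU]].
      exists [set q | if q is Some (existT n x) then B n else True].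
        by apply/nbhs_infinity; split => //; exists B.
      by move=> [[n x]|] //= Bn; exact: BU.
    move=> /nbhs_set_type[V xV VU]; exists (@fsum_in X n @` V).
      by apply: (@filterS _ _ _ V) => // z Vz; exists z.
    move=> [[m y]|] //=; last by move=> [].
    move=> [z Vz /Some_inj pq]; have nm := existT_inj1 pq; subst m.
    by apply: VU; move: Vz; rewrite (existT_inj2 pq).
Qed.

Lemma set_type_fsum_out X (A : set (fsum X)) : ~ A None ->
  {n & set_type (@fsum_in X n @^-1` A)} ≅ set_type A.
Proof.
move=> A0; apply: homeo_trans.
  exact: (@set_type_sigT _ _ ((Some : {n & X n} -> fsum X) @^-1` A)).
pose f (x : set_type ((Some : {n & X n} -> fsum X) @^-1` A)) : A :=
  exist _ (Some (val x)) (mem_set (set_mem (valP x))).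
have fS y : exists x, f x = y.
  case: y => -[x|] xA; last by case: A0; exact: set_mem xA.
  exists (exist _ x (mem_set (set_mem xA : (Some @^-1` A) x))).
  exact: val_inj.
apply: (@homeo_intro _ _ f) => //.
  by move=> x y [] /val_inj.
apply: local_homeo_to_set_type => //.
  by move=> x U xU; apply/nbhs_set_type; exists (Some @^-1` U).
move=> x U /nbhs_set_type[V xV VU]; exists (Some @` V).
  by apply: (@filterS _ _ _ V) => // z Vz; exists z.
by move=> z [t Vt /Some_inj tz]; rewrite tz in Vt; exact: VU.
Qed.

End FilterSum.

(** * Absorption *)

Definition absorbs (X Y : topologicalType) : Prop := (X + Y)%type ≅ X.

Definition copies (X : topologicalType) : topologicalType := {_ : nat & X}.

Section Absorption.
Implicit Types (X Y Z : topologicalType) (I J K : choiceType).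

Lemma absorbs_congr X X' Y Y' :
  X ≅ X' -> Y ≅ Y' -> absorbs X Y -> absorbs X' Y'.
Proof.
move=> XX YY XY; apply: homeo_trans (homeo_trans XY XX).
by apply: homeo_sym; exact: sum_congr.
Qed.

Lemma absorbs_antisym X Y : absorbs X Y -> absorbs Y X -> X ≅ Y.
Proof.
move=> XY YX; apply: homeo_trans (homeo_sym XY) _.
exact: homeo_trans (sum_comm _ _) YX.
Qed.

Lemma absorbs_addl X Y Z : absorbs X Y -> absorbs (X + Z)%type Y.
Proof.
move=> XY; apply: homeo_trans (sum_exchange _ _ _) _.
by apply: sum_congr => //; exact: homeo_refl.
Qed.

Lemma absorbs_sigT_fiber I K (p : K -> I) (X : I -> topologicalType)
    (Y : K -> topologicalType) :
  (forall i, absorbs (X i) {k : [set k | p k = i] & Y (val k)}) ->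
  absorbs {i & X i} {k & Y k}.
Proof.
move=> XY; apply: homeo_trans.
  by apply: sum_congr; [exact: homeo_refl|exact: (sigT_fiber p)].
apply: homeo_trans (sum_sigT _ _) _.
by apply: sigT_congr => i; exact: XY.
Qed.

(** Distinct summands absorb distinct spaces, so no summand has to absorb more
    than one of them at a time. *)
Lemma absorbs_sigT_inj I K (p : K -> I) (X : I -> topologicalType)
    (Y : K -> topologicalType) :
  injective p -> (forall k, absorbs (X (p k)) (Y k)) ->
  absorbs {i & X i} {k & Y k}.
Proof.
move=> pI XY; apply: (absorbs_sigT_fiber (p := p)) => i.
have [[k ki]|ki] := pselect (exists k, p k = i).
  subst i; apply: absorbs_congr (homeo_refl _) _ (XY k); apply: homeo_sym.
  apply: (@sigT_single _ (exist _ k (mem_set erefl) : [set j | p j = p k])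
    (fun k => Y (val k))) => -[j jP].
  apply: val_inj => /=; exact: pI (set_mem jP).
by apply: sum_empty => -[[k /set_mem kP] _]; apply: ki; exists k.
Qed.

Lemma absorbs_sigT1 I (i : I) (X : I -> topologicalType) Y :
  absorbs (X i) Y -> absorbs {i & X i} Y.
Proof.
move=> XY.
apply: (absorbs_congr (homeo_refl _) (@sigT_single _ tt (fun=> Y) _)).
  by case.
by apply: (absorbs_sigT_inj (p := fun=> i)) => // -[] [].
Qed.

Lemma infinite_countable_bij K : countable [set: K] -> infinite_set [set: K] ->
  exists2 e : nat -> K, injective e & forall k, exists n, e n = k.
Proof.
move=> cK iK.
have : ([set: nat] #= [set: K])%card.
  by rewrite card_eq_le; apply/andP; split => //; exact/infiniteP.
move=> /card_bijP[f [g fK gK]].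
pose T A (x : A) : [set: A] := exist _ x (mem_set I).
exists (fun n => val (f (T _ n))).
  by move=> m n /val_inj /(can_inj fK) [].
move=> k; exists (val (g (T _ k))).
have -> : T _ (val (g (T _ k))) = g (T _ k) by exact: val_inj.
by rewrite gK.
Qed.

Lemma countable_copies K X : countable [set: K] -> infinite_set [set: K] ->
  {k : K & X} ≅ copies X.
Proof.
move=> cK iK; have [e eI eS] := infinite_countable_bij cK iK.
by apply: homeo_sym; exact: (@sigT_reindex _ _ e (fun=> X)).
Qed.

Lemma countable_set_type I (D : set I) :
  countable [set: I] -> countable [set: D].
Proof.
move=> /countable_injP[f fI]; apply/countable_injP.
exists (f \o @set_val _ D) => x y _ _ /= fxy.
by apply: val_inj; apply: fI => //; exact: mem_setT.
Qed.

Lemma infinite_set_type I (D : set I) :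
  infinite_set D -> infinite_set [set: D].
Proof.
move=> iD fD; apply: iD; have -> : D = @set_val _ D @` setT.
  apply/seteqP; split=> [x Dx|_ [[x xD] _ <-]]; last exact: set_mem xD.
  by exists (exist _ x (mem_set Dx)).
exact: finite_image.
Qed.

Lemma copies_absorbs X : absorbs (copies X) X.
Proof.
apply: homeo_trans (sum_comm _ _) _; apply: homeo_sym.
apply: homeo_trans (sigT_split [set 0%N] _) _; apply: sum_congr.
  apply: (@sigT_single _ (exist _ 0%N (mem_set erefl) : [set 0%N]) (fun=> X)).
  by move=> [n nP]; apply: val_inj => /=; exact: (set_mem nP).
apply: countable_copies; first by apply: countable_set_type; exact: countableP.
apply: infinite_set_type; rewrite -setTD; apply: infinite_setD => //.
exact: infinite_nat.
Qed.

Lemma copies_copies X : copies (copies X) ≅ copies X.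
Proof.
apply: homeo_trans (@sigT_flatten nat nat (fun _ _ => X)) _.
by apply: countable_copies; [exact: countableP|exact: infinite_prod_nat].
Qed.

(** Infinitely many copies of X are infinitely many copies of themselves, which
    leaves a separate family of copies for each [Y k]. *)
Lemma copies_absorbs_sigT X K (Y : K -> topologicalType) :
  countable [set: K] -> (forall k, absorbs (copies X) (Y k)) ->
  absorbs (copies X) {k & Y k}.
Proof.
move=> /countable_injP[f fI] XY.
apply: (absorbs_congr (copies_copies X) (homeo_refl _)).
by apply: (absorbs_sigT_inj (p := f)) => // x y; apply: fI; exact: mem_setT.
Qed.

Lemma absorbs_copiesl X Y : absorbs X Y -> absorbs (copies X) Y.
Proof. exact: (@absorbs_sigT1 nat 0%N (fun=> X)). Qed.

Lemma sigT_absorbs_copies K (E : set K) (X : K -> topologicalType) Z :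
  countable [set: K] -> infinite_set E -> (forall k, E k -> X k ≅ Z) ->
  absorbs {k & X k} (copies Z).
Proof.
move=> cK iE XZ.
apply: (absorbs_congr (homeo_sym (sigT_split E X)) (homeo_refl _)).
apply: absorbs_addl.
have EZ : {k : E & X (val k)} ≅ copies Z.
  apply: homeo_trans (@sigT_congr E (fun k => X (val k)) (fun=> Z) _) _.
    by move=> [k kE]; apply: XZ; exact: set_mem.
  by apply: countable_copies; [exact: countable_set_type|
    exact: infinite_set_type].
apply: (absorbs_congr (homeo_sym EZ) (homeo_refl _)).
apply: copies_absorbs_sigT => [|_]; first exact: countableP.
exact: copies_absorbs.
Qed.

Lemma fsum_absorbs (F : set_system nat) (FF : ProperFilter F)
    (X : nat -> topologicalType) Y :
  F [set n | n <> 0%N] -> absorbs (X 0%N) Y -> absorbs (filter_sum FF X) Y.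
Proof.
move=> F0 XY.
apply: (absorbs_congr (homeo_sym (split_range _ _ _)) (homeo_refl _)).
- exact: (@fsum_in_inj _ FF X 0%N).
- exact: fsum_in_local_homeo.
- rewrite openE; set C := ~` _.
  have CE p : C p = ~ range (@fsum_in _ FF X 0%N) p by [].
  suff : forall p, C p -> nbhs p C by [].
  elim/fsum_case => [_|n x xr].
    apply/nbhs_infinity; split; first by rewrite CE; case.
    exists [set n | n <> 0%N] => // n x n0.
    rewrite /= CE => -[y _ /Some_inj pq].
    by apply: n0; rewrite (existT_inj1 pq).
  apply/fsum_in_local_homeo; apply: (@filterS _ _ _ setT); last exact: filterT.
  move=> y _; rewrite /preimage /= CE => -[z _ /Some_inj pq].
  have n0 := existT_inj1 pq; subst n.
  by move: xr; rewrite CE; apply; exists x.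
- exact: absorbs_addl.
Qed.

End Absorption.

(** * Ordinals *)

Section Ordinals.
Context {d : Order.disp_t} {W : orderType d}.
Variable wfW : well_founded (fun a b : W => a < b).
Implicit Types a b c : W.

Lemma wf_least (P : W -> Prop) :
  (exists a, P a) -> exists2 a, P a & forall b, P b -> a <= b.
Proof.
move=> [a]; elim/(well_founded_ind wfW) : a => a IH Pa.
have [[b Pb ba]|noP] := pselect (exists2 b, P b & b < a); first exact: (IH b).
by exists a => // b Pb; rewrite leNgt; apply/negP => ba; apply: noP; exists b.
Qed.

Lemma succ_exists b a : b < a -> exists2 c, is_succ b c & c <= a.
Proof.
move=> ba; have [|c bc cmin] := @wf_least (fun c => b < c).
  by exists a.
by exists c; [split|exact: cmin].
Qed.

Lemma is_succ_le b a c : is_succ b a -> c < a -> c <= b.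
Proof.
by move=> [_ ba] ca; rewrite leNgt; apply/negP => /ba; rewrite leNgt ca.
Qed.

Lemma is_limit_succ a b c : is_limit a -> b < a -> is_succ b c -> c < a.
Proof.
move=> [_ aS] ba bc; rewrite lt_neqAle; apply/andP; split.
  by apply/eqP => ca; subst c; exact: (aS b).
exact: (proj2 bc).
Qed.

Lemma ordinal_cases a : [\/ is_zero a, exists b, is_succ b a | is_limit a].
Proof.
have [?|a0] := pselect (is_zero a); first by constructor 1.
have [?|aS] := pselect (exists b, is_succ b a); first by constructor 2.
by constructor 3; split => // b ba; apply: aS; exists b.
Qed.

Lemma not_zero a : ~ is_zero a <-> exists b, b < a.
Proof.
split=> [a0|[b ba] /(_ b)]; last by rewrite leNgt ba.
by apply: contrapT => noa; apply: a0 => b; rewrite leNgt; apply/negP => ba;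
  apply: noa; exists b.
Qed.

Lemma zero_exists a : exists o : W, is_zero o.
Proof.
have [|o _ oP] := @wf_least (fun=> True); first by exists a.
by exists o => b; exact: oP.
Qed.

Section Omega1.
Variable (w0 : W) (w0P : is_omega1 w0).

(** The regularity of omega_1: otherwise the countable initial segments up to
    the elements of [A] would cover the uncountable segment below [w0]. *)
Lemma omega1_bounded (A : set W) :
  countable A -> (forall a, A a -> a < w0) ->
  exists2 x, x < w0 & forall a, A a -> a < x.
Proof.
move=> cA Aw; apply: contrapT => noub; apply: (proj1 w0P).
have : countable (\bigcup_(a in A) [set b | b <= a]).
  apply: bigcup_countable => // a Aa.
  pose C i := if i then [set b | b < a] else [set a].
  have cC : countable (\bigcup_(i in [set: bool]) C i).
    apply: bigcup_countable => // -[] _; last exact: countable1.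
    exact: (proj2 w0P) (Aw a Aa).
  apply: sub_countable cC; apply: subset_card_le => b /=.
  by rewrite le_eqVlt => /orP[/eqP ->|ba]; [exists false|exists true].
apply: sub_countable; apply: subset_card_le => x /= xw.
apply: contrapT => xA; apply: noub; exists x => // a Aa.
by rewrite ltNge; apply/negP => xa; apply: xA; exists a.
Qed.

Lemma omega1_limit : is_limit w0.
Proof.
have lt1 b : b < w0 -> exists2 x, x < w0 & b < x.
  move=> bw; have [||x xw xP] := @omega1_bounded [set b].
  - exact: countable1.
  - by move=> _ ->.
  - by exists x => //; exact: xP.
split.
  move=> z0; have [||x xw _] := @omega1_bounded set0 => //.
  by have := z0 x; rewrite leNgt xw.
move=> b [bw bS]; have [x xw bx] := lt1 b bw.
by have := bS x bx; rewrite leNgt xw.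
Qed.

End Omega1.
End Ordinals.

(** * Cantor-Bendixson derivatives *)

Section Derivatives.
Context {d : Order.disp_t} {W : orderType d}.
Variable wfW : well_founded (fun a b : W => a < b).
Implicit Types (a b c : W) (X Y : topologicalType).
Local Notation D := (cb_derivative wfW).

Lemma derived_setP X (A : set X) x :
  derived_set A x <-> A x /\ limit_point A x.
Proof.
split=> [[Ax nx]|[Ax lx]]; split => //.
  move=> U xU; apply: contrapT => noy; apply: nx; split; first exact: mem_set.
  exists U => //; apply/seteqP; split=> [y [Uy Ay]|_ ->].
    apply: contrapT => yx; apply: noy; exists y; split => //; exact/eqP.
  by split=> //; exact: nbhs_singleton.
move=> [_ [V xV VA]]; have [y [yx Ay Vy]] := lx _ xV.
move: VA => /seteqP[/(_ y (conj Vy Ay)) yx' _].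
by rewrite yx' eqxx in yx.
Qed.

Lemma cb_derivative0 X a : is_zero a -> D X a = setT.
Proof. by move=> a0; rewrite /cb_derivative transfinite_rec0. Qed.

Lemma cb_derivativeS X a b : is_succ b a -> D X a = derived_set (D X b).
Proof. by move=> ab; rewrite /cb_derivative (transfinite_recS _ _ _ _ ab). Qed.

Lemma cb_derivativeL X a : is_limit a ->
  D X a = \bigcap_(b in [set: {b : W | b < a}]) D X (val b).
Proof. by move=> aL; rewrite /cb_derivative transfinite_recL. Qed.

Lemma cb_derivative_anti X a b : b <= a -> D X a `<=` D X b.
Proof.
elim/(well_founded_ind wfW) : a b => a IH b.
rewrite le_eqVlt => /orP[/eqP ->//|ba].
have [a0|[c ca]|aL] := ordinal_cases a.
- by have := a0 b; rewrite leNgt ba.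
- rewrite (cb_derivativeS X ca) => x [cx _].
  exact: (IH c (proj1 ca) b (is_succ_le ca ba)).
- by rewrite (cb_derivativeL X aL) => x /(_ (exist _ b ba) I).
Qed.

(** This description does not distinguish zero, successor and limit ordinals,
    so that facts about derivatives follow from it by plain well-founded
    induction. *)
Lemma cb_derivativeP X a x :
  D X a x <-> forall b, b < a -> limit_point (D X b) x.
Proof.
elim/(well_founded_ind wfW) : a => a IH; split=> [ax b ba|lx].
  have [c bc ca] := succ_exists wfW ba.
  have := cb_derivative_anti ca ax.
  by rewrite (cb_derivativeS X bc) => /derived_setP[].
have [a0|[c ca]|aL] := ordinal_cases a.
- by rewrite cb_derivative0.
- rewrite (cb_derivativeS X ca); apply/derived_setP; split.
    apply/(IH _ (proj1 ca)) => b bc; apply: lx.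
    exact: lt_trans bc (proj1 ca).
  exact: lx (proj1 ca).
- rewrite (cb_derivativeL X aL) => -[b ba] _ /=.
  by apply/(IH _ ba) => c cb; apply: lx; exact: lt_trans ba.
Qed.

Lemma cb_derivative_local_homeo X Y (f : X -> Y) a x :
  injective f -> local_homeo f -> D Y a (f x) <-> D X a x.
Proof.
move=> fI fh; elim/(well_founded_ind wfW) : a x => a IH x.
rewrite !cb_derivativeP; split=> fx b ba U.
  move=> xU; have [|y [yx by_ [z Uz zy]]] := fx b ba (f @` U).
    by apply/fh; apply: filterS xU => t Ut; exists t.
  subst y; exists z; split => //; last exact/IH.
  by apply: contra_neq yx => ->.
move=> /fh fU; have [z [zx bz Uz]] := fx b ba _ fU.
exists (f z); split => //; last exact/IH.
by apply: contra_neq zx => /fI.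
Qed.

Lemma cb_derivative_set_type X (A : set X) a (x : A) :
  D A a x -> D X a (val x).
Proof.
elim/(well_founded_ind wfW) : a x => a IH x; rewrite !cb_derivativeP.
move=> xl b ba U xU; have [|y [yx yb Uy]] := xl b ba (@set_val _ A @^-1` U).
  by apply/nbhs_set_type; exists U.
exists (val y); split => //; exact: IH.
Qed.

Lemma homeo_cb_derivative X Y a : X ≅ Y -> D X a = set0 -> D Y a = set0.
Proof.
move=> /homeo_elim[f [fI fS fh]] X0; rewrite -subset0 => y.
by have [x <-] := fS y; rewrite (cb_derivative_local_homeo _ _ fI fh) X0.
Qed.

Lemma no_isolated_cb_derivative X a :
  isolated [set: X] = set0 -> D X a = setT.
Proof.
move=> X0; elim/(well_founded_ind wfW) : a => a IH.
apply/seteqP; split=> // x _; apply/cb_derivativeP => b ba.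
rewrite IH //; have : derived_set [set: X] x.
  by rewrite /derived_set X0 setD0.
by move=> /derived_setP[].
Qed.

Lemma cb_derivative_infinity (F : set_system nat) (FF : ProperFilter F)
    (X : nat -> topologicalType) a :
  D (filter_sum FF X) a None <->
  forall b A, b < a -> F A -> exists2 n, A n & D (X n) b !=set0.
Proof.
elim/(well_founded_ind wfW) : a => a IH; rewrite cb_derivativeP.
split=> [ainf b A ba FA|aP b ba U /nbhs_infinity[_ [A FA AU]]].
  have [|y] := ainf b ba [set p | if p is Some (existT n _) then A n else True].
    by apply/nbhs_infinity; split => //; exists A.
  elim/fsum_case : y; first by move=> [].
  move=> n x [_ bx An]; exists n => //; exists x.
  apply/(cb_derivative_local_homeo b x (@fsum_in_inj _ FF X n)) => //.
have [n An [x bx]] := aP b A ba FA.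
exists (fsum_in FF x); split => //; last exact: AU.
exact/(cb_derivative_local_homeo b x (@fsum_in_inj _ FF X n)).
Qed.

End Derivatives.

(** * Homogeneous filters isomorphic to their product with \omega *)

Lemma infinite_inj (T : Type) (A : set T) (f : nat -> T) :
  injective f -> (forall n, A (f n)) -> infinite_set A.
Proof.
move=> fI fA; apply/infiniteP; apply: (@card_le_trans _ _ _ (range f)).
  have : (range f #= [set: nat])%card by apply: inj_card_eq => x y _ _ /fI.
  by rewrite card_eq_le => /andP[].
by apply: subset_card_le => _ [n _ <-]; exact: fA.
Qed.

Section Filters.
Variables (F : set_system nat) (FF : ProperFilter F).
Variable F_homogeneous : homogeneous_filter F.

(** A singleton cannot be positive: the trace of F on it lives on a one-point
    set, which is not in bijection with omega. *)
Lemma homogeneous_free k : F [set n | n <> k].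
Proof.
have [kpos|kpos] := pselect (positive_sets F [set k]).
  have [t [g tK gK] _] := F_homogeneous kpos.
  have gE m n : g m = g n.
    by apply: val_inj; rewrite /= (set_mem (valP (g m))) (set_mem (valP (g n))).
  by have := congr1 t (gE 0%N 1%N); rewrite !gK.
apply: contrapT => Fk; apply: kpos => A FA; apply: contrapT => kA; apply: Fk.
by apply: filterS FA => n An nk; apply: kA; exists k; split => //; rewrite -nk.
Qed.

Lemma homogeneous_gt k : F [set n | (k < n)%N].
Proof.
elim: k => [|k IH].
  by apply: filterS (homogeneous_free 0) => -[].
apply: filterS2 IH (homogeneous_free k.+1) => n /= kn nk.
by rewrite ltn_neqAle kn andbT; apply/eqP => kn'; apply: nk.
Qed.

(** The trace of F on [C] is the filter induced on [C] by pulling F back along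
    [q]. *)
Definition trace_map (C : set nat) (q : nat -> nat) : Prop :=
  (forall G, F G -> exists2 B, F B & C `&` B `<=` q @^-1` G) /\
  (forall B, F B -> exists2 G, F G & C `&` q @^-1` G `<=` B).

(** Homogeneity identifies a positive set with omega, and a map preserving F
    can then be transported to it. *)
Lemma trace_map_comp (C : set nat) (g : nat -> nat) :
  positive_sets F C -> preserves_filter F g ->
  exists t : nat -> nat, [/\ trace_map C (g \o t),
    forall m n, C m -> C n -> t m = t n -> m = n &
    forall n, exists2 m, C m & t m = n].
Proof.
move=> /F_homogeneous[t tb tP] [gF Fg].
have tI := bij_inj tb; have [t' tK t'K] := tb.
pose tt n :=
  if pselect (C n) is left nC then t (exist _ n (mem_set nC)) else 0%N.
have ttE (x : C) : tt (val x) = t x.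
  rewrite /tt; case: pselect => [nC|[]]; last exact: set_mem (valP x).
  by congr t; exact: val_inj.
have valE n (Cn : C n) : exists x : C, val x = n.
  by exists (exist _ n (mem_set Cn)).
exists tt; split.
- split=> [G /gF Gg|B FB].
    have /tP[B FB BE] : F (t @` (t @^-1` (g @^-1` G))).
      apply: filterS Gg => n Gn; exists (t' n); rewrite /= ?t'K //.
    exists B => // n [/valE[x <-] Bx] /=.
    rewrite ttE; have : (@set_val _ C @^-1` B) x by [].
    by rewrite BE.
  have /Fg[G FG GB] : F (t @` (@set_val _ C @^-1` B)).
    by apply/tP; exists B.
  exists G => // n [/valE[x <-]] /=; rewrite ttE => Gx.
  by have [y By /tI yx] := GB (t x) Gx; rewrite -yx.
- by move=> m n /valE[x <-] /valE[y <-]; rewrite !ttE => /tI ->.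
- move=> n; exists (val (t' n)); first exact: set_mem (valP (t' n)).
  by rewrite ttE t'K.
Qed.

Lemma preserves_filter_id : preserves_filter F id.
Proof. by split=> // B FB; exists B. Qed.

(** If [C] is not positive its trace is improper and a constant map will do,
    since F is free. *)
Lemma trace_map_exists C : exists q, trace_map C q.
Proof.
have [/trace_map_comp /(_ preserves_filter_id)|Cpos] :=
    pselect (positive_sets F C).
  by move=> [t [? _ _]]; exists (id \o t).
have [A FA CA] : exists2 A, F A & C `&` A = set0.
  apply: contrapT => noA; apply: Cpos => A FA; apply: contrapT => CA.
  by apply: noA; exists A => //; apply/nonemptyPn.
exists (fun=> 0%N); split=> [G FG|B FB].
  by exists A => //; rewrite CA.
exists [set n | n <> 0%N]; first exact: homogeneous_free.
by move=> n [].
Qed.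

Hypothesis F_times_omega : filter_iso F (filter_times_omega F).

Lemma omega_fibers : exists2 p, preserves_filter F p &
  forall i, exists f : nat -> nat, injective f /\ forall j, p (f j) = i.
Proof.
have [u ub uP] := F_times_omega.
have uI := bij_inj ub; have [u' uK u'K] := ub.
exists (fst \o u); last first.
  move=> i; exists (fun j => u' (i, j)).
  split; last by move=> j; rewrite /= u'K.
  by move=> j k /(can_inj u'K) [].
split=> [G FG|B FB].
  apply/uP; exists G => // -[i j] /= [Gi _].
  by exists (u' (i, j)); rewrite /= ?u'K.
have /uP[G FG GB] := FB; exists G => // n Gn.
have [|m Bm /uI <-//] := GB (u n).
by split.
Qed.

(** On [A] the map is the projection of omega x omega, transported through the
    isomorphisms of the trace of F with F and of F with F x omega; outside [A]
    any map inducing the trace of F extends it. *)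
Lemma infinite_fibers A : positive_sets F A ->
  exists2 p, preserves_filter F p &
  forall i, infinite_set (A `&` p @^-1` [set i]).
Proof.
have [g gF gi] := omega_fibers.
move=> /trace_map_comp /(_ gF)[t [[gt1 gt2] tI tS]].
have [q [q1 q2]] := trace_map_exists (~` A).
pose p n := if pselect (A n) then g (t n) else q n.
have pA n : A n -> p n = g (t n) by rewrite /p; case: pselect.
have pA' n : ~ A n -> p n = q n by rewrite /p; case: pselect.
exists p; last first.
  move=> i; have [f [fI fi]] := gi i.
  have /choice[h hP] : forall j, exists m, A m /\ t m = f j.
    by move=> j; have [m Am mj] := tS (f j); exists m.
  apply: (@infinite_inj _ _ h).
    move=> j k jk; apply: fI.
    by rewrite -(proj2 (hP j)) -(proj2 (hP k)) jk.
  move=> j; have [Aj tj] := hP j; split => //=.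
  by rewrite (pA _ Aj) tj.
split=> [G FG|B FB].
  have [B1 FB1 B1G] := gt1 _ FG; have [B2 FB2 B2G] := q1 _ FG.
  apply: filterS2 FB1 FB2 => n B1n B2n /=.
  have [An|An] := pselect (A n); first by rewrite pA //; exact: B1G.
  by rewrite pA' //; exact: B2G.
have [G1 FG1 G1B] := gt2 _ FB; have [G2 FG2 G2B] := q2 _ FB.
exists (G1 `&` G2); first exact: filterI.
move=> n /= [G1n G2n]; have [An|An] := pselect (A n).
  by apply: G1B; split => //=; rewrite -pA.
by apply: G2B; split => //=; rewrite -pA'.
Qed.

(** Regrouping along a map with infinite fibres on [A] spreads the pieces over
    [A] so that every block contains infinitely many of them. *)
Lemma fsum_regroup A (X : nat -> topologicalType) Z :
  positive_sets F A ->
  (forall D : set nat, infinite_set (A `&` D) -> {n : D & X (val n)} ≅ Z) ->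
  filter_sum FF X ≅ filter_sum FF (fun=> Z).
Proof.
move=> /infinite_fibers[p pF pi] XZ; apply: homeo_trans (fsum_fiber FF X pF) _.
by apply: fsum_congr => i; exact: (XZ _ (pi i)).
Qed.

Lemma fsum_copies Z :
  filter_sum FF (fun=> Z) ≅ filter_sum FF (fun=> copies Z).
Proof.
apply: (@fsum_regroup setT) => [A FA|D].
  by rewrite setTI; exact: (filter_ex FA).
rewrite setTI => iD; apply: countable_copies; last exact: infinite_set_type.
by apply: countable_set_type; exact: countableP.
Qed.

End Filters.

(** * The spaces T_\alpha *)

Section TSpaces.
Context {d : Order.disp_t} {W : orderType d}.
Variable wfW : well_founded (fun a b : W => a < b).
Variables (F : set_system nat) (FF : ProperFilter F).
Variable F_homogeneous : homogeneous_filter F.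
Hypothesis F_times_omega : filter_iso F (filter_times_omega F).
Implicit Types (a b c g : W) (X Y Z : topologicalType).
Local Notation T := (T_space wfW FF).
Local Notation D := (cb_derivative wfW).

Lemma T_zero a : is_zero a -> T a -> False.
Proof. by move=> a0; rewrite /T_space transfinite_rec0 // => -[]. Qed.

Lemma T_limit a : is_limit a ->
  T a = ({b : {b : W | b < a} & T (val b)} : topologicalType).
Proof. by move=> aL; rewrite {1}/T_space transfinite_recL. Qed.

Lemma T_succ_eq b a : is_succ b a -> ~ is_zero b ->
  T a = (filter_sum FF (fun=> T b) : topologicalType).
Proof.
move=> ab b0; rewrite {1}/T_space (transfinite_recS _ _ _ _ ab).
by case: pselect.
Qed.

(** For [b] zero the sum of empty pieces consists of the point oo alone, which
    makes the one-point space T_1 an instance of the successor step. *)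
Lemma T_succ b a : is_succ b a -> T a ≅ filter_sum FF (fun=> T b).
Proof.
move=> ab; have [b0|b0] := pselect (is_zero b); last first.
  by rewrite (T_succ_eq ab b0); exact: homeo_refl.
have -> : T a = (unit : topologicalType).
  by rewrite /T_space (transfinite_recS _ _ _ _ ab); case: pselect.
apply: homeo_sym.
apply: (@homeo_intro _ _ (fun _ : filter_sum FF (fun=> T b) => tt)).
- by move=> [[n x]|] [[m y]|] // _; case: (T_zero b0) => //.
- by case; exists None.
- elim/fsum_case => [U|n x]; last by case: (T_zero b0 x).
  rewrite nbhs_infinity; split=> [Utt|[Utt _]].
    have U0 : U tt by exact: (@nbhs_singleton unit).
    split => //; exists setT; first exact: filterT.
    by move=> n x; case: (T_zero b0 x).
  by move=> [].
Qed.

Lemma T_rank a : D (T a) a = set0 /\ forall b, b < a -> D (T a) b !=set0.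
Proof.
elim/(well_founded_ind wfW) : a => a IH.
have [a0|[c ca]|aL] := ordinal_cases a.
- split; first by rewrite -subset0 => x; case: (T_zero a0 x).
  by move=> b ba; have := a0 b; rewrite leNgt ba.
- have [c0 cP] := IH c (proj1 ca).
  suff [X0 XP] : D (filter_sum FF (fun=> T c)) a = set0 /\
      forall b, b < a -> D (filter_sum FF (fun=> T c)) b !=set0.
    have Ta := homeo_sym (T_succ ca).
    split; first exact: homeo_cb_derivative Ta X0.
    move=> b ba; apply/set0P/eqP => Tb; have [x] := XP b ba.
    by rewrite (homeo_cb_derivative (homeo_sym Ta) Tb).
  split.
    have Dc p : D (filter_sum FF (fun=> T c)) c p -> p = None.
      elim/fsum_case : p => // n x.
      rewrite (cb_derivative_local_homeo _ _ _
        (@fsum_in_inj _ FF (fun=> T c) n)) //.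
      by rewrite c0.
    rewrite (cb_derivativeS _ _ ca) -subset0 => p /derived_setP[/Dc -> lp].
    have [|q [qp /Dc qN _]] := lp setT; first exact: filterT.
    by rewrite qN eqxx in qp.
  move=> b ba; exists None; apply/cb_derivative_infinity => b' A bb' FA.
  have [n An] := filter_ex FA; exists n => //; apply: cP.
  exact: lt_le_trans bb' (is_succ_le ca ba).
- rewrite (T_limit aL); split=> [|b ba].
    rewrite -subset0 => -[[b ba] x] ax.
    have [Tb0 _] := IH b ba.
    have : D (T b) a x.
      exact/(cb_derivative_local_homeo wfW a x (@existT_inj _
        (fun b : {b : W | b < a} => T (val b)) (exist _ b ba))).
    by move=> /(cb_derivative_anti (ltW ba)); rewrite Tb0.
  have [c bc _] := succ_exists wfW ba; have ca := is_limit_succ aL ba bc.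
  have [_ /(_ b (proj1 bc))[x bx]] := IH c ca.
  exists (existT _ (exist _ c ca) x).
  exact/(cb_derivative_local_homeo wfW b x (@existT_inj _
    (fun b : {b : W | b < a} => T (val b)) (exist _ c ca))).
Qed.

Lemma T_copies b a : is_succ b a -> T a ≅ filter_sum FF (fun=> copies (T b)).
Proof. by move=> /T_succ Ta; apply: homeo_trans Ta _; exact: fsum_copies. Qed.

End TSpaces.

(** * Sums of spaces T_\alpha *)

(** Choose the values of the injection by recursion along [R], avoiding the
    values chosen before. *)
Lemma greedy_injection (K J : Type) (R : K -> K -> Prop) (Q : K -> J -> Prop) :
  well_founded R -> (forall k l, [\/ k = l, R k l | R l k]) ->
  (forall k (f : {l | R l k} -> J), exists j, Q k j /\ forall l, f l <> j) ->
  exists2 phi : K -> J, injective phi & forall k, Q k (phi k).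
Proof.
move=> wfR totR QR.
pose step k (rec : forall l, R l k -> J) : J :=
  projT1 (cid (QR k (fun s => rec (sval s) (svalP s)))).
pose phi := Fix wfR (fun=> J) step.
have phiE k : phi k = step k (fun l _ => phi l).
  rewrite /phi Fix_eq // => x f g fg; congr step.
  by apply/functional_extensionality_dep => b;
    apply/functional_extensionality_dep => ba.
have phiP k : Q k (phi k) /\ forall l, R l k -> phi l <> phi k.
  rewrite phiE /step; case: cid => j [Qj jP] /=; split => // l lk.
  exact: (jP (exist _ l lk)).
exists phi => [k l kl|k]; last exact: (proj1 (phiP k)).
case: (totR k l) => // [/(proj2 (phiP l))//|/(proj2 (phiP k))].
by rewrite kl.
Qed.

Lemma measure_wf (K : Type) (i : K -> nat) :
  well_founded (fun k l => (i k < i l)%N).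
Proof.
have wfn n k : (i k < n)%N -> Acc (fun k l => (i k < i l)%N) k.
  elim: n k => [k|n IH k kn]; first by rewrite ltn0.
  by constructor => l lk; apply: IH; exact: leq_trans lk kn.
by move=> k; exact: (wfn (i k).+1 k (ltnSn _)).
Qed.

Section SumsOfT.
Context {d : Order.disp_t} {W : orderType d}.
Variable wfW : well_founded (fun a b : W => a < b).
Variables (F : set_system nat) (FF : ProperFilter F).
Hypothesis F_homogeneous : homogeneous_filter F.
Hypothesis F_times_omega : filter_iso F (filter_times_omega F).
Implicit Types (a b c g : W) (X Y Z : topologicalType).
Local Notation T := (T_space wfW FF).
Local Notation D := (cb_derivative wfW).

Lemma countable_below g :
  countable [set b | b < g] -> countable [set: {b : W | b < g}].
Proof.
move=> /countable_injP[f fI]; apply/countable_injP.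
exists (f \o val) => x y _ _ /= fxy; apply: val_inj; apply: fI => //.
  by apply: mem_set; exact: (valP x).
by apply: mem_set; exact: (valP y).
Qed.

(** The piece at the place 0 can be detached from the point oo, as F is free,
    and it consists of infinitely many copies of T_b. *)
Lemma T_succ_absorbs b a Y :
  is_succ b a -> absorbs (copies (T b)) Y -> absorbs (T a) Y.
Proof.
move=> ba bY.
apply: (absorbs_congr (homeo_sym
  (T_copies wfW FF F_homogeneous F_times_omega ba)) (homeo_refl _)).
by apply: fsum_absorbs => //; exact: homogeneous_free.
Qed.

Lemma T_absorbs b g : b < g -> absorbs (T g) (T b).
Proof.
elim/(well_founded_ind wfW) : g => g IH bg.
have [g0|[c cg]|gL] := ordinal_cases g.
- by have := g0 b; rewrite leNgt bg.
- apply: (T_succ_absorbs cg); have := is_succ_le cg bg.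
  rewrite le_eqVlt => /orP[/eqP ->|bc]; first exact: copies_absorbs.
  exact: absorbs_copiesl (IH c (proj1 cg) bc).
- have [c bc _] := succ_exists wfW bg; have cg := is_limit_succ gL bg bc.
  rewrite (T_limit wfW FF gL); apply: (@absorbs_sigT1 _ (exist _ c cg)).
  exact: T_succ_absorbs bc (copies_absorbs _).
Qed.

Lemma copies_T_absorbs b g : b <= g -> absorbs (copies (T g)) (T b).
Proof.
rewrite le_eqVlt => /orP[/eqP ->|bg]; first exact: copies_absorbs.
exact: absorbs_copiesl (T_absorbs bg).
Qed.

(** As T_0 is empty, indexing by all of [nat] covers the finite sums too. *)
Definition sum_of_T g Y : Prop :=
  exists2 beta : nat -> W, forall n, beta n <= g & Y ≅ {n & T (beta n)}.

Lemma sum_of_T_homeo g X Y : X ≅ Y -> sum_of_T g X -> sum_of_T g Y.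
Proof.
move=> XY [beta bg bX]; exists beta => //.
exact: homeo_trans (homeo_sym XY) bX.
Qed.

Lemma sum_of_T_mono g g' Y : g <= g' -> sum_of_T g Y -> sum_of_T g' Y.
Proof. by move=> gg [beta bg bY]; exists beta => // n; exact: le_trans gg. Qed.

Lemma countable_padding (K : choiceType) (c : K -> W) g :
  countable [set: K] -> (forall k, c k <= g) ->
  exists beta (i : K -> nat), [/\ injective i, forall n, beta n <= g,
    forall k, beta (i k) = c k & {k & T (c k)} ≅ {n & T (beta n)}].
Proof.
move=> /countable_injP[i iI'] cg.
have iI : injective i by move=> x y; apply: iI'; exact: mem_setT.
have [o o0] := zero_exists wfW g.
pose beta n := if pselect (exists k, i k = n) is left e then c (projT1 (cid e))
  else o.
have bi k : beta (i k) = c k.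
  rewrite /beta; case: pselect => [e|[]]; last by exists k.
  by case: cid => l /= /iI ->.
exists beta, i; split => //.
  by move=> n; rewrite /beta; case: pselect => [e|_]; [exact: cg|exact: o0].
apply: homeo_trans (sigT_fiber i (fun k => T (c k))) _.
apply: sigT_congr => n; have [[k kn]|nk] := pselect (exists k, i k = n).
  subst n; rewrite bi.
  apply: (@sigT_single _ (exist _ k (mem_set erefl) : [set j | i j = i k])
    (fun k => T (c (val k)))) => -[j jP].
  by apply: val_inj => /=; exact: iI (set_mem jP).
apply: homeo_empty.
  by move=> [[k /set_mem kP] _]; apply: nk; exists k.
by apply: T_zero; rewrite /beta; case: pselect.
Qed.

Lemma sum_of_T_sigT (K : choiceType) (Y : K -> topologicalType) g :
  countable [set: K] -> (forall k, sum_of_T g (Y k)) -> sum_of_T g {k & Y k}.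
Proof.
move=> cK Yg.
have /choice[c cP] : forall k, exists beta : nat -> W,
    (forall n, beta n <= g) /\ Y k ≅ {n & T (beta n)}.
  by move=> k; have [beta ? ?] := Yg k; exists beta.
have cKN : countable [set: K * nat].
  by rewrite -setXTT; exact: countableX.
have [|beta [i [_ bg _ hb]]] := @countable_padding _ (fun p => c p.1 p.2) g cKN.
  by move=> p; exact: (proj1 (cP p.1)).
exists beta => //; apply: homeo_trans hb.
apply: homeo_trans (sigT_congr (fun k => proj2 (cP k))) _.
exact: (@sigT_flatten _ _ (fun k n => T (c k n))).
Qed.

Lemma sum_of_T_T b g : b <= g -> sum_of_T g (T b).
Proof.
move=> bg; have cu : countable [set: unit] by exact: countableP.
have [//|beta [i [_ bg' _ hb]]] := @countable_padding _ (fun=> b) g cu.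
exists beta => //; apply: homeo_trans hb; apply: homeo_sym.
by apply: (@sigT_single _ tt (fun=> T b)) => -[].
Qed.

Lemma sum_of_T_empty g Y : (Y -> False) -> sum_of_T g Y.
Proof.
move=> Y0; have [o o0] := zero_exists wfW g.
apply: sum_of_T_homeo (sum_of_T_T (o0 g)).
exact: homeo_empty (T_zero o0) Y0.
Qed.

Lemma sum_of_T_add g X Y :
  sum_of_T g X -> sum_of_T g Y -> sum_of_T g (X + Y)%type.
Proof.
move=> gX gY; pose Z (b : bool) : topologicalType := if b then X else Y.
have : sum_of_T g {b & Z b}.
  by apply: sum_of_T_sigT => [|[]] //; exact: countableP.
apply: sum_of_T_homeo; apply: homeo_trans (sigT_split [set true] Z) _.
apply: sum_congr.
  apply: (@sigT_single _ (exist _ true (mem_set erefl) : [set true])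
    (fun k => Z (val k))).
  by move=> [j jP]; apply: val_inj => /=; exact: (set_mem jP).
have nt : (~` [set true]) false by [].
apply: (@sigT_single _ (exist _ false (mem_set nt) : set_type (~` [set true]))
    (fun k => Z (val k))).
by move=> [[] jP]; apply: val_inj => //=; case: (set_mem jP).
Qed.

Lemma copies_T_absorbs_sum g Y : sum_of_T g Y -> absorbs (copies (T g)) Y.
Proof.
move=> [beta bg bY].
apply: (absorbs_congr (homeo_refl _) (homeo_sym bY)).
apply: copies_absorbs_sigT => [|n]; first exact: countableP.
exact: copies_T_absorbs.
Qed.

(** The copies of T_g absorb the sum because its summands are T_b with
    [b <= g].  Conversely, for successor [g] the hypothesis provides infinitely
    many summands T_g, and for limit [g] the spaces T_b of which T_g is the sum
    can be matched injectively with larger summands. *)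
Lemma ample_sum_homeo (beta : nat -> W) g :
  countable [set b | b < g] -> (forall n, beta n <= g) ->
  (forall g', g' < g -> infinite_set [set n | g' < beta n]) ->
  {n & T (beta n)} ≅ copies (T g).
Proof.
move=> cg bg ba; apply: absorbs_antisym; last first.
  by apply: copies_T_absorbs_sum; exists beta => //; exact: homeo_refl.
have [g0|[c cC]|gL] := ordinal_cases g.
- by apply: sum_empty => -[_ x]; exact: (T_zero g0 x).
- apply: (sigT_absorbs_copies (countableP _) (ba c (proj1 cC))) => n /= cb.
  have -> : beta n = g; last exact: homeo_refl.
  by apply/eqP; rewrite eq_le bg; exact: (proj2 cC).
have Tg : copies (T g) ≅ {p : nat * {b : W | b < g} & T (val p.2)}.
  rewrite (T_limit wfW FF gL).
  exact: (@sigT_flatten nat {b : W | b < g} (fun _ s => T (val s))).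
apply: (absorbs_congr (homeo_refl _) (homeo_sym Tg)).
have : countable [set: nat * {b : W | b < g}].
  by rewrite -setXTT; apply: countableX => //; exact: countable_below.
move=> /countable_injP[i iI'].
have iI : injective i by move=> x y; apply: iI'; exact: mem_setT.
have [| | |phi phiI phiP] := @greedy_injection (nat * {b : W | b < g}) nat
    (fun k l => (i k < i l)%N) (fun p n => val p.2 < beta n).
- exact: measure_wf.
- move=> k l; have [kl|lk|/iI ->] := ltngtP (i k) (i l).
  + by constructor 2.
  + by constructor 3.
  + by constructor 1.
- move=> k f; have finf : finite_set (range f).
    apply: finite_image.
    have -> : [set: {l | (i l < i k)%N}] =
        (i \o sval) @^-1` [set n | (n < i k)%N].
      by apply/seteqP; split=> // -[].
    apply: finite_preimage; last exact: finite_II.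
    move=> x y _ _ /= /iI; exact: val_inj.
  have /infinite_setN0[n [/= kn nf]] :=
    infinite_setD (ba (val k.2) (valP k.2)) finf.
  by exists n; split => // l fl; apply: nf; exists l.
by apply: (absorbs_sigT_inj (p := phi)) => // k; exact: T_absorbs.
Qed.

End SumsOfT.

(** * Subspaces of T_\alpha for countable \alpha *)

Section CountableSubspaces.
Context {d : Order.disp_t} {W : orderType d}.
Variable wfW : well_founded (fun a b : W => a < b).
Variables (F : set_system nat) (FF : ProperFilter F).
Hypothesis F_homogeneous : homogeneous_filter F.
Hypothesis F_times_omega : filter_iso F (filter_times_omega F).
Implicit Types (a b c g : W) (X Y Z : topologicalType).
Local Notation T := (T_space wfW FF).
Local Notation D := (cb_derivative wfW).
Hypothesis F_finite_to_one : forall f : nat -> nat,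
  (forall A, F A -> unbounded_on f A) ->
  exists2 A, positive_sets F A & finite_to_one_on f A.

Lemma filter_positiveT : positive_sets F setT.
Proof. by move=> A FA; rewrite setTI; exact: (filter_ex FA). Qed.

Lemma enumerate_below g : countable [set b | b < g] -> (exists b, b < g) ->
  exists2 e : nat -> W, forall m, e m < g &
  forall b, b < g -> exists m, e m = b.
Proof.
move=> /countable_injP[f fI] [b0 b0g].
pose e m := if pselect (exists2 b, b < g & f b = m) is left E
  then projT1 (cid2 E) else b0.
exists e => [m|b bg].
  by rewrite /e; case: pselect => // E; case: cid2.
exists (f b); rewrite /e; case: pselect => [E|[]]; last by exists b.
case: cid2 => c cg cb /=.
by apply: fI => //; exact: mem_set.
Qed.

Lemma initial_bound (e : nat -> W) g m : (forall j, e j < g) ->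
  exists2 c, c < g & forall j, (j <= m)%N -> e j <= c.
Proof.
move=> eg; elim: m => [|m [c cg cP]].
  by exists (e 0%N) => // j; rewrite leqn0 => /eqP ->.
have [ce|ec] := leP c (e m.+1).
  exists (e m.+1) => // j; rewrite leq_eqVlt => /orP[/eqP ->//|].
  by rewrite ltnS => /cP jc; exact: le_trans ce.
exists c => // j; rewrite leq_eqVlt => /orP[/eqP ->|]; first exact: ltW.
by rewrite ltnS => /cP.
Qed.

(** Let [e] enumerate the ordinals below [g], and let [f n] be the first [m] for
    which [e m] bounds the summands of [Z n], or [n] if there is none.  If [f]
    were bounded on a set of F, then, as F is free, finitely many [e m], hence
    the largest of them, would suffice for F-almost all [n].  So [f] is
    finite-to-one on a positive set. *)
Lemma thin_positive_set g (Z : nat -> topologicalType) :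
  countable [set b | b < g] ->
  (forall g', g' < g -> ~ F [set n | sum_of_T wfW FF g' (Z n)]) ->
  exists2 A, positive_sets F A & forall g', g' < g ->
    finite_set (A `&` [set n | sum_of_T wfW FF g' (Z n)]).
Proof.
move=> cg Fg; have [g0|g0] := pselect (exists b, b < g); last first.
  by exists setT; [exact: filter_positiveT|move=> g' gg; case: g0; exists g'].
have [e eg eS] := enumerate_below cg g0.
pose f n := if pselect (exists m, `[< sum_of_T wfW FF (e m) (Z n) >]) is left E
  then ex_minn E else n.
have fP n m : sum_of_T wfW FF (e m) (Z n) -> (f n <= m)%N.
  move=> Zn; rewrite /f; case: pselect => [E|[]]; last first.
    by exists m; exact/asboolP.
  by case: ex_minnP => k _; apply; exact/asboolP.
have fE n : (f n < n)%N -> sum_of_T wfW FF (e (f n)) (Z n).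
  rewrite /f; case: pselect => [E|]; last by rewrite ltnn.
  by case: ex_minnP => k /asboolP.
have [|A Apos Afin] := @F_finite_to_one f.
  move=> A FA m; apply: contrapT => noA.
  have [c cg' cP] := initial_bound m eg.
  apply: (Fg c cg').
  have FAm : F (A `&` [set n | (m < n)%N]).
    by apply: filterI => //; exact: homogeneous_gt.
  apply: filterS FAm => n [An /= mn].
  have fm : (f n <= m)%N.
    by rewrite leqNgt; apply/negP => mf; apply: noA; exists n.
  exact: sum_of_T_mono (cP _ fm) (fE _ (leq_ltn_trans fm mn)).
exists A => // g' /eS[m em]; apply: (@sub_finite_set _ _
    (\bigcup_(k in `I_m.+1) (A `&` f @^-1` [set k]))).
  move=> n [An /= Zn]; exists (f n) => //=.
  by rewrite ltnS; apply: fP; rewrite em.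
by apply: bigcup_finite => // k _; exact: Afin.
Qed.

(** For each [g' < g], all but finitely many [Z n] over the set [A] given by
    [thin_positive_set] have a summand T_b with [g' < b].  After regrouping this
    is what [ample_sum_homeo] needs. *)
Lemma fsum_collapse g (Z : nat -> topologicalType) :
  countable [set b | b < g] -> (forall n, sum_of_T wfW FF g (Z n)) ->
  (forall g', g' < g -> ~ F [set n | sum_of_T wfW FF g' (Z n)]) ->
  filter_sum FF Z ≅ filter_sum FF (fun=> T g).
Proof.
move=> cg Zg Fg; have [A Apos Afin] := thin_positive_set cg Fg.
apply: homeo_trans
  (homeo_sym (fsum_copies FF F_homogeneous F_times_omega (T g))).
apply: (fsum_regroup FF F_homogeneous F_times_omega Apos) => E iE.
have /choice[beta bP] : forall n, exists beta : nat -> W,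
    (forall k, beta k <= g) /\ Z n ≅ {k & T (beta k)}.
  by move=> n; have [beta ? ?] := Zg n; exists beta.
have [||gam [i [iI gg gi gh]]] := @countable_padding _ _ wfW _ FF (E * nat)%type
    (fun p => beta (val p.1) p.2) g.
- rewrite -setXTT; apply: countableX; last exact: countableP.
  by apply: countable_set_type; exact: countableP.
- by move=> p; exact: (proj1 (bP _)).
apply: homeo_trans (sigT_congr (fun n : E => proj2 (bP (val n)))) _.
apply: homeo_trans (@sigT_flatten E nat (fun n k => T (beta (val n) k))) _.
apply: homeo_trans gh _; apply: ample_sum_homeo => // g' gg'.
move=> fing; apply: iE.
apply: (@sub_finite_set _ _ ((A `&` [set n | sum_of_T wfW FF g' (Z n)]) `|`
    (fun p : E * nat => val p.1) @` (i @^-1` [set n | g' < gam n]))).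
  move=> n [An En]; have [Zn|Zn] := pselect (sum_of_T wfW FF g' (Z n)).
    by left.
  right; have [k gk] : exists k, g' < beta n k.
    apply: contrapT => nok; apply: Zn.
    exists (beta n); last exact: (proj2 (bP n)).
    by move=> k; rewrite leNgt; apply/negP => gk; apply: nok; exists k.
  by exists (exist _ n (mem_set En), k) => //=; rewrite gi.
rewrite finite_setU; split; first exact: Afin.
apply/finite_image/finite_preimage => // x y _ _; exact: iI.
Qed.

(** Take the least [g] that bounds the pieces of the subspace over some set [B]
    of F.  The clopen part over [B] collapses to T_(g + 1), and the part outside
    [B] is a countable sum of subspaces of T_c. *)
Lemma fsum_subspace_sum_of_T c a (A : set (filter_sum FF (fun=> T c))) :
  countable [set b | b <= c] -> is_succ c a ->
  (forall B : set (T c), sum_of_T wfW FF c (set_type B)) ->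
  sum_of_T wfW FF a (set_type A).
Proof.
move=> cc ca IH.
have outP (B : set (filter_sum FF (fun=> T c))) : ~ B None ->
    sum_of_T wfW FF a (set_type B).
  move=> B0; apply: sum_of_T_homeo (set_type_fsum_out B0) _.
  apply: sum_of_T_sigT => [|n]; first exact: countableP.
  exact: sum_of_T_mono (ltW (proj1 ca)) (IH _).
have [A0|/outP//] := pselect (A None).
pose An n : set (T c) := @fsum_in _ FF (fun=> T c) n @^-1` A.
have [|g FB gmin] := @wf_least _ _ wfW
    (fun g => F [set n | sum_of_T wfW FF g (set_type (An n))]).
  by exists c; apply: filterS filterT => n _; exact: IH.
have gc : g <= c by apply: gmin; apply: filterS filterT => n _; exact: IH.
set B := [set n | _] in FB.
pose C : set (filter_sum FF (fun=> T c)) :=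
  [set p | if p is Some (existT n _) then B n else True].
have oC : open C.
  rewrite openE; elim/fsum_case => [_|n x Bn].
    by apply/nbhs_infinity; split => //; exists B.
  apply/fsum_in_local_homeo; apply: (@filterS _ _ _ setT); last exact: filterT.
  by move=> y _.
have oC' : open (~` C).
  rewrite openE; elim/fsum_case => [/(_ I)//|n x Bn].
  apply/fsum_in_local_homeo; apply: (@filterS _ _ _ setT); last exact: filterT.
  by move=> y _.
apply: sum_of_T_homeo (homeo_sym (set_type_split A oC oC')) _.
apply: sum_of_T_add; last by apply: outP => -[_]; apply.
have AC0 : (A `&` C) None by split.
apply: sum_of_T_homeo (set_type_fsum_in AC0) _.
pose Z n : topologicalType :=
  set_type (@fsum_in _ FF (fun=> T c) n @^-1` (A `&` C)).
have ZB n : B n -> Z n = set_type (An n) :> topologicalType.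
  move=> Bn; rewrite /Z; congr (set_type _ : topologicalType).
  by apply/seteqP; split=> x; [case|split].
have ZB' n : ~ B n -> Z n -> False by move=> Bn [x /set_mem[]].
have [g1 gg1 g1a] : exists2 g1, is_succ g g1 & g1 <= a.
  exact: (succ_exists wfW (le_lt_trans gc (proj1 ca))).
apply: (@sum_of_T_homeo _ _ _ _ _ _ (T g1)); last exact: sum_of_T_T.
apply: homeo_sym; apply: homeo_trans (homeo_sym (T_succ wfW FF gg1)).
apply: fsum_collapse.
- apply: sub_countable cc; apply: subset_card_le => b /= bg.
  exact: ltW (lt_le_trans bg gc).
- move=> n; have [Bn|Bn] := pselect (B n); first by rewrite -/(Z n) ZB.
  exact: sum_of_T_empty (ZB' n Bn).
- move=> g' gg' FZ.
  have FBZ : F (B `&` [set n | sum_of_T wfW FF g' (Z n)]) by exact: filterI.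
  have : F [set n | sum_of_T wfW FF g' (set_type (An n))].
    by apply: filterS FBZ => n [Bn /=]; rewrite -/(Z n) ZB.
  by move=> /gmin; rewrite leNgt gg'.
Qed.

Lemma T_subspace_sum_of_T a (A : set (T a)) :
  countable [set b | b < a] -> sum_of_T wfW FF a (set_type A).
Proof.
elim/(well_founded_ind wfW) : a A => a IH A ca.
have {}IH b (B : set (T b)) : b < a -> sum_of_T wfW FF b (set_type B).
  move=> ba; apply: IH => //; apply: sub_countable ca.
  by apply: subset_card_le => c /= cb; exact: lt_trans ba.
have [a0|[c cC]|aL] := ordinal_cases a.
- by apply: sum_of_T_empty => -[x _]; exact: (T_zero a0 x).
- have [h [hI hS hh]] := homeo_elim (homeo_sym (T_succ wfW FF cC)).
  apply: sum_of_T_homeo (set_type_homeo A hI hS hh) _.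
  have cc : countable [set b | b <= c].
    apply: sub_countable ca; apply: subset_card_le => b /= bc.
    exact: le_lt_trans (proj1 cC).
  apply: (@fsum_subspace_sum_of_T c a (h @^-1` A) cc cC) => B.
  exact: IH (proj1 cC).
- move: A; rewrite (T_limit wfW FF aL) => A.
  apply: sum_of_T_homeo (set_type_sigT A) _.
  apply: sum_of_T_sigT => [|[b ba]]; last first.
    exact: sum_of_T_mono (ltW ba) (IH _ _ ba).
  exact: countable_below.
Qed.

End CountableSubspaces.

(** * Rank \omega_1 and \omega_1 + 1 *)

Section RankOmega1.
Context {d : Order.disp_t} {W : orderType d}.
Variable wfW : well_founded (fun a b : W => a < b).
Variables (F : set_system nat) (FF : ProperFilter F).
Hypothesis F_homogeneous : homogeneous_filter F.
Hypothesis F_times_omega : filter_iso F (filter_times_omega F).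
Implicit Types (a b c g : W) (X Y Z : topologicalType).
Local Notation T := (T_space wfW FF).
Local Notation D := (cb_derivative wfW).
Hypothesis F_finite_to_one : forall f : nat -> nat,
  (forall A, F A -> unbounded_on f A) ->
  exists2 A, positive_sets F A & finite_to_one_on f A.
Variables (w0 : W) (w0P : is_omega1 w0).
Local Notation S := {b : W | b < w0}.

(** The part of [Y] in the summand T_b is a countable sum of spaces of index at
    most [b], and so it is absorbed by the summand T_(b + 1). *)
Lemma T_omega1_absorbs (Y : set (T w0)) : absorbs (T w0) (set_type Y).
Proof.
have w0L := omega1_limit w0P.
move: Y; rewrite (T_limit wfW FF w0L) => Y.
apply: (absorbs_congr (homeo_refl _) (set_type_sigT Y)).
have sS (s : S) : exists t : S, is_succ (val s) (val t).
  have [c sc _] := succ_exists wfW (valP s).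
  by exists (exist _ c (is_limit_succ w0L (valP s) sc)).
have [p pP] := choice sS.
apply: (absorbs_sigT_inj (p := p)).
  move=> s t st; apply: val_inj; apply: is_succ_inj (pP s) _.
  by rewrite st; exact: pP.
move=> s; apply: (T_succ_absorbs F_homogeneous F_times_omega (pP s)).
apply: copies_T_absorbs_sum => //; apply: T_subspace_sum_of_T => //.
exact: (proj2 w0P) (valP s).
Qed.

Lemma below_wf : well_founded (fun s t : S => val s < val t).
Proof.
have wfb b (s : S) : val s = b -> Acc (fun s t : S => val s < val t) s.
  elim/(well_founded_ind wfW) : b s => b IH s sb.
  by constructor => t ts; apply: (IH (val t)); rewrite -?sb.
by move=> s; exact: wfb erefl.
Qed.

(** By [T_omega1_absorbs] it remains that the sum of spaces T_(be p) to which
    [Y] decomposes absorbs T_omega_1.  The ordinals [be p] are unbounded, since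
    [Y] has rank omega_1, so each [b] can be sent to a new [p] with
    [b < be p]: only countably many [p] have been used before. *)
Lemma T_omega1_subspace (Y : set (T w0)) :
  (forall b, b < w0 -> D (set_type Y) b !=set0) -> T w0 ≅ set_type Y.
Proof.
have w0L := omega1_limit w0P.
move=> Yb; apply: absorbs_antisym; first exact: T_omega1_absorbs.
move: Y Yb; rewrite (T_limit wfW FF w0L) => Y Yb.
have /choice[beta bP] : forall s : S, exists beta : nat -> W,
    (forall n, beta n <= val s) /\
    set_type (@existT S (fun s => T (val s)) s @^-1` Y) ≅ {n & T (beta n)}.
  move=> s; have [|beta ? ?] := @T_subspace_sum_of_T _ _ wfW _ FF F_homogeneous
    F_times_omega F_finite_to_one (val s)
    (@existT S (fun s => T (val s)) s @^-1` Y).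
  - exact: (proj2 w0P) (valP s).
  - by exists beta.
pose be (p : S * nat) := beta p.1 p.2.
have YE : set_type Y ≅ {p : S * nat & T (be p)}.
  apply: homeo_trans (homeo_sym (set_type_sigT Y)) _.
  apply: homeo_trans (sigT_congr (fun s => proj2 (bP s))) _.
  exact: (@sigT_flatten S nat (fun s n => T (beta s n))).
have bew p : be p < w0 by exact: le_lt_trans (proj1 (bP _) _) (valP p.1).
have big x : x < w0 -> exists p, x < be p.
  move=> /Yb Yx; apply: contrapT => nop.
  suff Dx : D {p : S * nat & T (be p)} x = set0.
    by move: Yx; rewrite (homeo_cb_derivative (homeo_sym YE) Dx) => -[].
  rewrite -subset0 => -[p u].
  move=> /(cb_derivative_local_homeo wfW x u
    (@existT_inj _ (fun p => T (be p)) p) (@existT_local_homeo _ _ p)) Du.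
  apply: nop; exists p; rewrite ltNge; apply/negP => px.
  have := cb_derivative_anti px Du.
  by rewrite (proj1 (T_rank _ _ _)).
apply: (absorbs_congr (homeo_sym YE) (homeo_refl _)).
have [| | |phi phiI phiP] := @greedy_injection S (S * nat)%type
    (fun s t => val s < val t) (fun s p => val s < be p).
- exact: below_wf.
- move=> s t; have [st|ts|/val_inj ->] := ltgtP (val s) (val t).
  + by constructor 2.
  + by constructor 3.
  + by constructor 1.
- move=> s f; have cf : countable (be @` range f).
    do 2![apply: (sub_countable (card_image_le _ _))].
    have /countable_injP[i iI] := (proj2 w0P) _ (valP s).
    apply/countable_injP; exists (fun t => i (val (sval t))) => t t' _ _ /= tt'.
    have /val_inj : val (sval t) = val (sval t').
      by apply: iI => //; apply: mem_set; [exact: (svalP t)|exact: (svalP t')].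
    by move: t t' {tt'} => [t tP] [t' t'P] /= tt'; subst t'; congr exist;
      exact: bool_irrelevance.
  (* [x] bounds the ordinals of all values chosen before [s]. *)
  have [|x xw xP] := omega1_bounded w0P cf.
    by move=> _ [p _ <-]; exact: bew.
  have [|p xp] := big (Order.max x (val s)).
    by rewrite gt_max xw; exact: (valP s).
  move: xp; rewrite gt_max => /andP[xp sp].
  exists p; split => // t tp; have : be p < x.
    by apply: xP; exists p => //; exists t.
  by rewrite ltNge (ltW xp).
apply: (absorbs_sigT_inj (p := phi)) => // s.
exact: (T_absorbs wfW FF F_homogeneous F_times_omega (phiP s)).
Qed.

Lemma T_scattered_of_rank a : scattered_of_rank wfW a (T a).
Proof.
have [Ta Tb] := T_rank wfW FF a; split => // b /Tb[x bx] b0.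
by rewrite b0 in bx.
Qed.

Lemma T_omega1_Toronto : Toronto wfW w0 (T w0).
Proof.
split; first exact: T_scattered_of_rank.
move=> Y [_ Yb]; apply: T_omega1_subspace => b bw.
exact/set0P/eqP/(Yb b bw).
Qed.

(** If the set [A] of places where the piece has rank omega_1 were not positive,
    the ranks of the pieces over some set of F would be bounded below omega_1,
    countably many as they are, and oo would not survive to level omega_1. *)
Lemma fsum_omega1_subspace (Y : set (filter_sum FF (fun=> T w0))) :
  D (set_type Y) w0 !=set0 -> filter_sum FF (fun=> T w0) ≅ set_type Y.
Proof.
pose Z n : topologicalType := set_type (@fsum_in _ FF (fun=> T w0) n @^-1` Y).
have Zw n (x : Z n) : ~ D (Z n) w0 x.
  by move=> /cb_derivative_set_type; rewrite (proj1 (T_rank _ _ _)).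
have [Y0|Y0] := pselect (Y None); last first.
  move=> [y yw]; suff Dw : D {n & Z n} w0 = set0.
    by move: yw; rewrite (homeo_cb_derivative (set_type_fsum_out Y0) Dw).
  rewrite -subset0 => -[n x].
  by move=> /(cb_derivative_local_homeo wfW w0 x (@existT_inj _ Z n)
    (@existT_local_homeo _ _ n)) /Zw.
have YE : filter_sum FF Z ≅ set_type Y := set_type_fsum_in Y0.
move=> Yw; have /(@cb_derivative_infinity _ _ wfW _ FF Z) Zb :
    D (filter_sum FF Z) w0 None.
  apply: contrapT => DN; have [y yw] := Yw.
  suff Dw : D (filter_sum FF Z) w0 = set0.
    by move: yw; rewrite (homeo_cb_derivative YE Dw).
  rewrite -subset0; elim/fsum_case => // n x.
  by move=> /(cb_derivative_local_homeo wfW w0 x (@fsum_in_inj _ FF Z n)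
    (@fsum_in_local_homeo _ FF Z n)) /Zw.
apply: homeo_trans YE.
pose A := [set n | forall b, b < w0 -> D (Z n) b !=set0].
have Apos : positive_sets F A.
  move=> B FB; apply: contrapT => AB.
  have /choice[c cP] : forall n, exists b, B n -> b < w0 /\ D (Z n) b = set0.
    move=> n; have [Bn|?] := pselect (B n); last by exists w0.
    apply: contrapT => nob; apply: AB; exists n; split => // b bw.
    by apply/set0P/eqP => Db; apply: nob; exists b.
  have [||x xw xP] := @omega1_bounded _ _ _ w0P (c @` B).
  - by apply: (sub_countable (card_image_le _ _)); exact: countableP.
  - by move=> _ [n /cP[? _] <-].
  have [n Bn [y xy]] := Zb x B xw FB; have [_ Dc] := cP n Bn.
  have := cb_derivative_anti (ltW (xP _ (ex_intro2 _ _ n Bn erefl))) xy.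
  by rewrite Dc.
apply: homeo_trans (fsum_copies FF F_homogeneous F_times_omega (T w0)) _.
apply: homeo_sym.
apply: (fsum_regroup FF F_homogeneous F_times_omega Apos) => E iE.
have cE : countable [set: E] by apply: countable_set_type; exact: countableP.
apply: absorbs_antisym; last first.
  by apply: copies_absorbs_sigT => // n; apply: absorbs_copiesl;
    exact: T_omega1_absorbs.
apply: (@sigT_absorbs_copies _ [set n : E | A (val n)]) => //; last first.
  by move=> n nA; apply: homeo_sym; exact: T_omega1_subspace.
move=> fE; apply: iE; apply: sub_finite_set (finite_image val fE).
by move=> n [An En]; exists (exist _ n (mem_set En)).
Qed.

Lemma T_omega1S_Toronto w1 : is_succ w0 w1 -> Toronto wfW w1 (T w1).
Proof.
move=> w01; split; first exact: T_scattered_of_rank.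
have w0N : ~ is_zero w0 by exact: (proj1 (omega1_limit w0P)).
rewrite (T_succ_eq wfW FF w01 w0N) => Y [_ Yb].
apply: fsum_omega1_subspace.
exact/set0P/eqP/(Yb w0 (proj1 w01)).
Qed.

End RankOmega1.

(** * Isolated points and uncountable levels *)

Lemma isolatedTP (X : topologicalType) (x : X) :
  isolated [set: X] x <-> nbhs x [set x].
Proof.
split=> [[_ [V xV]]|xx]; first by rewrite setIT => <-.
by split; [exact: mem_setT|exists [set x] => //; rewrite setIT].
Qed.

Lemma isolated_local_homeo (X Y : topologicalType) (f : X -> Y) x :
  injective f -> local_homeo f ->
  isolated [set: Y] (f x) <-> isolated [set: X] x.
Proof.
move=> fI fh; rewrite !isolatedTP fh.
suff -> : f @^-1` [set f x] = [set x] by [].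
by apply/seteqP; split=> [y /fI|y ->].
Qed.

Lemma countable_inj_image (A B : Type) (f : A -> B) (C : set A) (E : set B) :
  injective f -> (forall x, C x -> E (f x)) -> countable E -> countable C.
Proof.
move=> fI fC; have : (f @` C #= C)%card by apply: inj_card_eq => x y _ _ /fI.
move=> /eq_countable <-; apply: sub_countable; apply: subset_card_le.
by move=> _ [x Cx <-]; exact: fC.
Qed.

Lemma countable_local_homeo_range (X Y : topologicalType) (f : X -> Y) x :
  local_homeo f -> countable [set: X] ->
  exists2 U, nbhs (f x) U & countable U.
Proof.
move=> fh cX; exists (range f).
  by apply/fh; apply: filterS (filterT : nbhs x setT) => y _; exists y.
by apply: (sub_countable (card_image_le _ _)).
Qed.

Section Omega1Levels.
Context {d : Order.disp_t} {W : orderType d}.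
Variable wfW : well_founded (fun a b : W => a < b).
Variables (F : set_system nat) (FF : ProperFilter F).
Hypothesis F_homogeneous : homogeneous_filter F.
Implicit Types (a b c g : W) (X Y Z : topologicalType).
Local Notation T := (T_space wfW FF).
Local Notation D := (cb_derivative wfW).

Lemma cb_level0 X a : is_zero a -> cb_level wfW X a = isolated [set: X].
Proof.
move=> a0; rewrite /cb_level cb_derivative0 // /derived_set.
by rewrite setDD setTI.
Qed.

(** Without isolated points all derivatives would be the whole space. *)
Lemma T_has_isolated a : ~ is_zero a -> exists x : T a, isolated setT x.
Proof.
move=> /not_zero[b ba]; apply: contrapT => noi.
have i0 : isolated [set: T a] = set0.
  by rewrite -subset0 => x xi; apply: noi; exists x.
have [a0 /(_ b ba)[x _]] := T_rank wfW FF a.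
by move: a0; rewrite no_isolated_cb_derivative // -subset0 => /(_ x I).
Qed.

Lemma countable_T a : countable [set b | b < a] -> countable [set: T a].
Proof.
elim/(well_founded_ind wfW) : a => a IH ca.
have {}IH b : b < a -> countable [set: T b].
  move=> ba; apply: IH => //; apply: sub_countable ca.
  by apply: subset_card_le => c /= cb; exact: lt_trans ba.
have [a0|[c cC]|aL] := ordinal_cases a.
- suff -> : [set: T a] = set0 by [].
  by rewrite -subset0 => x; case: (T_zero a0 x).
- have [h [hI _ _]] := homeo_elim (T_succ wfW FF cC).
  apply: (countable_inj_image (f := h) (E := setT)) => //.
  have -> : [set: filter_sum FF (fun=> T c)] =
      \bigcup_(i in [set: option nat]) (if i is Some n
        then range (@fsum_in _ FF (fun=> T c) n) else [set None]).
    apply/seteqP; split=> // p _; elim/fsum_case : p; first by exists None.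
    by move=> n x; exists (Some n) => //; exists x.
  apply: bigcup_countable => // -[n|] _; last exact: countable1.
  by apply: (sub_countable (card_image_le _ _)); exact: IH (proj1 cC).
- rewrite (T_limit wfW FF aL) sigT_setUE; apply: bigcup_countable.
    exact: countable_below.
  move=> [b ba] _; apply: (sub_countable (card_image_le _ _)); exact: IH.
Qed.

Variables (w0 w1 w2 : W) (w0P : is_omega1 w0).
Hypotheses (w01 : is_succ w0 w1) (w12 : is_succ w1 w2).
Hypothesis F_times_omega : filter_iso F (filter_times_omega F).

Lemma T_omega1_isolated_uncountable : ~ countable (isolated [set: T w0]).
Proof.
have w0L := omega1_limit w0P; rewrite (T_limit wfW FF w0L) => cL.
set L := isolated _ in cL.
pose A : set W := (fun p : {s : {b | b < w0} & T (val s)} => val (tag p)) @` L.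
have [||x xw xP] := @omega1_bounded _ _ _ w0P A.
- by apply: (sub_countable (card_image_le _ _)).
- by move=> _ [p _ <-]; exact: (valP (tag p)).
have [c xc _] := succ_exists wfW xw; have cw := is_limit_succ w0L xw xc.
have [|u ui] := @T_has_isolated c.
  by apply/not_zero; exists x; exact: (proj1 xc).
have : c < x.
  apply: xP; exists (existT _ (exist _ c cw) u) => //.
  by apply/(isolated_local_homeo _ (@existT_inj _ _ _)).
by rewrite ltNge (ltW (proj1 xc)).
Qed.

Lemma T_omega1_level_uncountable :
  ~ (forall a, countable (cb_level wfW (T w0) a)).
Proof.
move=> cL; have [o o0] := zero_exists wfW w0.
by have := cL o; rewrite cb_level0 //; exact: T_omega1_isolated_uncountable.
Qed.

Lemma w0_neq0 : ~ is_zero w0.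
Proof. exact: (proj1 (omega1_limit w0P)). Qed.

Lemma T_omega1S_level_uncountable :
  ~ (forall a, countable (cb_level wfW (T w1) a)).
Proof.
move=> cL; have [o o0] := zero_exists wfW w0.
move: (cL o); rewrite cb_level0 // (T_succ_eq wfW FF w01 w0_neq0) => ci.
apply: T_omega1_isolated_uncountable.
apply: (countable_inj_image (@fsum_in_inj _ FF (fun=> T w0) 0%N) _ ci) => x xi.
exact/(isolated_local_homeo x (@fsum_in_inj _ FF (fun=> T w0) 0%N)).
Qed.

(** * Rank \omega_1 + 2 *)

(** The invariant that separates a subspace of T_(omega_1 + 2) from the whole
    space. *)
Definition large_point X : Prop :=
  exists2 x, ~ D X w0 x & forall U, nbhs x U -> ~ countable U.

Lemma large_point_local_homeo X Y (f : X -> Y) :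
  injective f -> local_homeo f -> large_point X -> large_point Y.
Proof.
move=> fI fh [x Dx xU]; exists (f x).
  by move=> /(cb_derivative_local_homeo wfW w0 x fI fh).
by move=> U /fh /xU fU cU; apply: fU; exact: (countable_inj_image fI _ cU).
Qed.

Lemma T_omega1_not_large : ~ large_point (T w0).
Proof.
have w0L := omega1_limit w0P.
rewrite (T_limit wfW FF w0L) => -[[[b bw] x] _] xU.
pose S : choiceType := {b | b < w0}.
have [|U /xU] := countable_local_homeo_range x
  (@existT_local_homeo S (fun s => T (val s)) (exist _ b bw)).
  by apply: countable_T; exact: (proj2 w0P).
by [].
Qed.

Lemma fsum_not_large (X : nat -> topologicalType) :
  (forall n b, b < w0 -> D (X n) b !=set0) ->
  (forall n, ~ large_point (X n)) -> ~ large_point (filter_sum FF X).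
Proof.
move=> Xb Xl [p]; elim/fsum_case : p => [DN _|n x Dx xU].
  apply: DN; apply/cb_derivative_infinity => b A bw FA.
  by have [n An] := filter_ex FA; exists n => //; exact: Xb.
apply: (Xl n); exists x.
  move=> xw; apply: Dx; apply/cb_derivative_local_homeo => //.
  exact: fsum_in_inj.
move=> U xU' cU; apply: (xU (@fsum_in _ FF X n @` U)).
  by apply/fsum_in_local_homeo; apply: filterS xU' => y Uy; exists y.
exact: (sub_countable (card_image_le _ _)).
Qed.

(** The pieces are discrete, so that oo has level 1, and uncountable, so that
    every neighbourhood of oo is uncountable. *)
Lemma isolated_points_large :
  large_point (filter_sum FF (fun=> set_type (isolated [set: T w0]))).
Proof.
pose L : set (T w0) := isolated [set: T w0]; rewrite -/L; exists None.
  have w0L := omega1_limit w0P; have [o o0] := zero_exists wfW w0.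
  have ow : o < w0 by have [b] := (not_zero w0).1 w0_neq0; exact: le_lt_trans.
  (* [c] is the ordinal 1. *)
  have [c oc _] := succ_exists wfW ow; have cw := is_limit_succ w0L ow oc.
  move=> /cb_derivative_infinity /(_ c setT cw filterT)[_ _ [x]].
  rewrite (cb_derivativeS _ _ oc) cb_derivative0 // => /derived_setP[_ lx].
  have [|y [yx _ /= yE]] := lx [set x]; last by rewrite yE eqxx in yx.
  apply/nbhs_set_type; exists [set val x]; last by move=> z /val_inj ->.
  by apply/isolatedTP; exact: (set_mem (valP x)).
move=> U /nbhs_infinity[_ [A FA AU]] cU.
have [n An] := filter_ex FA; apply: T_omega1_isolated_uncountable.
have : countable [set: L].
  apply: (countable_inj_image (@fsum_in_inj _ FF (fun=> set_type L) n) _ cU).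
  by move=> x _; exact: AU.
rewrite -/L => cL; have -> : L = @set_val _ L @` setT.
  apply/seteqP; split=> [x Lx|_ [x _ <-]]; last exact: (set_mem (valP x)).
  by exists (exist _ x (mem_set Lx)).
exact: (sub_countable (card_image_le _ _)).
Qed.

(** The subspace [Y] keeps everything except over the place 0, where it keeps
    the point oo of T_(omega_1 + 1) and the isolated points of the copies of
    T_omega_1.  The other places still form a set of F, so the rank does not
    drop. *)
Lemma T_omega1SS_not_Toronto : ~ Toronto wfW w2 (T w2).
Proof.
have w1N : ~ is_zero w1 by apply/not_zero; exists w0; exact: (proj1 w01).
pose X1 : topologicalType := filter_sum FF (fun=> T w0).
have T1 : T w1 = X1 := T_succ_eq wfW FF w01 w0_neq0.
have [T2r _] := T_rank wfW FF w2.
rewrite (T_succ_eq wfW FF w12 w1N) in T2r *.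
have [_ X1b] := T_rank wfW FF w1; rewrite {}T1 in T2r X1b *.
move=> [_ Tor].
pose L := isolated [set: T w0].
pose Y0 : set X1 := [set p | if p is Some (existT _ u) then L u else True].
pose Y : set (filter_sum FF (fun=> X1)) :=
  [set p | if p is Some (existT n q) then n = 0%N -> Y0 q else True].
pose Z n : topologicalType := set_type (@fsum_in _ FF (fun=> X1) n @^-1` Y).
have YE : filter_sum FF Z ≅ set_type Y by exact: set_type_fsum_in.
have Ylarge : large_point (set_type Y).
  have [h [hI _ hh]] := homeo_elim YE; apply: large_point_local_homeo hI hh _.
  apply: (large_point_local_homeo (@fsum_in_inj _ FF Z 0%N)) => //.
  have -> : Z 0%N = set_type Y0.
    rewrite /Z; congr (set_type _ : topologicalType).
    by apply/seteqP; split=> q /=; [apply|].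
  have Y0N : Y0 None by [].
  have [k [kI _ kh]] := homeo_elim (set_type_fsum_in Y0N).
  exact: large_point_local_homeo kI kh isolated_points_large.
have Yrank : scattered_of_rank wfW w2 (set_type Y).
  split; first by rewrite -subset0 => y /cb_derivative_set_type; rewrite T2r.
  move=> b bw Yb; suff : D (filter_sum FF Z) b None.
    by rewrite (homeo_cb_derivative (homeo_sym YE) Yb).
  apply/cb_derivative_infinity => b' A bb' FA.
  have FA0 : F (A `&` [set n | n <> 0%N]).
    by apply: filterI => //; exact: homogeneous_free.
  have [n [An n0]] := filter_ex FA0.
  exists n => //.
  have [x bx] : D X1 b' !=set0.
    by apply: X1b; exact: lt_le_trans bb' (is_succ_le w12 bw).
  apply/set0P/eqP => Zb.
  have ZX : Z n ≅ X1 by apply: set_typeT => q /n0.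
  by have := homeo_cb_derivative ZX Zb; rewrite -subset0 => /(_ x bx).
have [h [hI _ hh]] := homeo_elim (homeo_sym (Tor Y Yrank)).
have := large_point_local_homeo hI hh Ylarge.
have T0b b : b < w0 -> D (T w0) b !=set0 by have [_] := T_rank wfW FF w0; exact.
apply: fsum_not_large => [n b bw|n].
  by apply: X1b; exact: lt_trans (proj1 w01).
apply: fsum_not_large => [_ b|_]; first exact: T0b.
exact: T_omega1_not_large.
Qed.

End Omega1Levels.

(** * The Toronto property up to \omega_1 + 2 *)

Theorem theorem2p13
  (d : Order.disp_t) (W : orderType d)
  (wfW : well_founded (fun a b : W => a < b))
  (w0 w1 w2 : W)
  (omega1 : is_omega1 w0)
  (omega1_plus1 : is_succ w0 w1)
  (omega1_plus2 : is_succ w1 w2)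
  (F : set_system nat) (FF : ProperFilter F)
  (F_homogeneous : homogeneous_filter F)
  (F_times_omega : filter_iso F (filter_times_omega F))
  (F_finite_to_one : forall f : nat -> nat,
     (forall A, F A -> unbounded_on f A) ->
     exists2 A, positive_sets F A & finite_to_one_on f A) :
  [/\ Toronto wfW w0 (T_space wfW FF w0),
      Toronto wfW w1 (T_space wfW FF w1),
      ~ (forall a : W, countable (cb_level wfW (T_space wfW FF w0) a)),
      ~ (forall a : W, countable (cb_level wfW (T_space wfW FF w1) a)) &
      ~ Toronto wfW w2 (T_space wfW FF w2)].
Proof.
split.
- exact: T_omega1_Toronto.
- exact: (T_omega1S_Toronto wfW FF F_homogeneous F_times_omega F_finite_to_one
    omega1 omega1_plus1).
- exact: T_omega1_level_uncountable.
- exact: T_omega1S_level_uncountable omega1 omega1_plus1.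
- exact: T_omega1SS_not_Toronto omega1 omega1_plus1 omega1_plus2.
Qed.
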